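(* Let $X$ be an infinite set, and let $\rho$ be the number of cardinals $\mu$ satisfying $\aleph_0\leq\mu\leq|X|$. (i) $\operatorname{rank}(\mathcal F_X:\mathcal G_X)=2+2\rho$. (ii) If $\rho<\aleph_0$, and if $\Omega\subseteq\mathcal F_X$ with $|\Omega|=2+2\rho$, then $\mathcal F_X=\langle\mathcal G_X\cup\Omega\rangle$ if and only if $\Omega$ can be written as $\Omega=\{\alpha_\mu,\beta_\mu : \mu=1\text{ or }\aleph_0\leq\mu\leq|X|\}$ (indexed by cardinals $\mu$), where for each $\mu$, $$t(\alpha_\mu)=t(\beta_\mu)=|X|,\qquad s(\alpha_\mu)<\mu=h(\alpha_\mu),\qquad h(\beta_\mu)<\mu=s(\beta_\mu),$$ and either - $s^*(\alpha_\mu)<\mu=h^*(\alpha_\mu)$ and $h^*(\beta_\mu)<\mu=s^*(\beta_\mu)$, or - $h^*(\alpha_\mu)<\mu=s^*(\alpha_\mu)$ and $s^*(\beta_\mu)<\mu=h^*(\beta_\mu)$.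
   Context: Partial Brauer monoid. Let $X$ be a set and $X'=\{x':x\in X\}$ a disjoint copy of $X$. A Brauer graph is an (undirected) graph with vertex set $X\cup X'$ in which every vertex has degree at most $1$; $\mathcal{PB}_X$ is the set of all of them. Product: let $X''=\{x'':x\in X\}$ be another disjoint copy of $X$; given $\alpha,\beta\in\mathcal{PB}_X$, let $\alpha^\vee$ be $\alpha$ with each vertex $x'$ renamed $x''$, let $\beta^\wedge$ be $\beta$ with each vertex $x\in X$ renamed $x''$, and let $\Pi(\alpha,\beta)$ be the graph on $X\cup X'\cup X''$ with all edges of $\alpha^\vee$ and $\beta^\wedge$. Then $\alpha\beta$ is the graph on $X\cup X'$ with an edge $\{x,y\}$ whenever $x,y\in X\cup X'$ are distinct and lie in the same connected component of $\Pi(\alpha,\beta)$. This makes $\mathcal{PB}_X$ a monoid with identity the graph with edge set $\{\{x,x'\}:x\in X\}$. For $\alpha\in\mathcal{PB}_X$, the following cardinals are defined: $t(\alpha)$ is the number of transversals (edges $\{x,y'\}$ with $x,y\in X$, possibly $x=y$); $h(\alpha)$ the number of upper hooks (edges $\{x,y\}$ with $x,y\in X$ distinct); $h^*(\alpha)$ the number of lower hooks (edges $\{x',y'\}$ with $x,y\in X$ distinct); $s(\alpha)$ the number of upper singletons (vertices $x\in X$ of degree $0$); $s^*(\alpha)$ the number of lower singletons (vertices $x'\in X'$ of degree $0$). $\mathcal G_X$ denotes the group of (two-sided) units of $\mathcal{PB}_X$; $\mathcal F_X$ denotes the subsemigroup of $\mathcal{PB}_X$ generated by all idempotents of $\mathcal{PB}_X$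 together with $\mathcal G_X$. For a subset $U$ of a semigroup $S$, $\langle U\rangle$ is the subsemigroup generated by $U$. For $A\subseteq S$, the relative rank is $\operatorname{rank}(S:A)=\min\{|U| : U\subseteq S,\ S=\langle A\cup U\rangle\}$. *)

(* Defs.v *)
From mathcomp Require Import all_boot.
From Stdlib Require Import Relation_Operators.
From mathcomp Require Import boolp classical_sets functions cardinality.

Set Implicit Arguments.
Unset Strict Implicit.
Unset Printing Implicit Defensive.

Local Open Scope classical_set_scope.
Local Open Scope card_scope.

(** * Cardinals

   Every cardinal that is at most |X| is the cardinality of a subset of X; it
   is represented by the class of all subsets of X having that cardinality. *)

Definition card_lt T U (A : set T) (B : set U) : Prop :=
  A #<= B /\ ~ (A #= B).
Notation "A '#<' B" := (card_lt A B) (at level 79) : card_scope.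

Definition card_add T U (A : set T) (B : set U) : set (T + U) :=
  (inl @` A) `|` (inr @` B).

Definition cardinal_of X (A : set X) : set (set X) := [set B | B #= A].

(** The infinite cardinals m <= |X|; the number rho is the cardinality of this
   set. *)
Definition infinite_cardinals X : set (set (set X)) :=
  [set cardinal_of A | A in [set A : set X | [set: nat] #<= A]].
Arguments infinite_cardinals X : clear implicits.

Definition cardinal_one X : set (set (set X)) :=
  [set cardinal_of A | A in [set A : set X | A #= [set: unit]]].
Arguments cardinal_one X : clear implicits.

(** |E| = m and |E| < m, where m is a class [cardinal_of A] and E is a set over
   any type. *)
Definition has_card X T (E : set T) (m : set (set X)) : Prop :=
  exists2 A, m A & E #= A.
Definition has_card_lt X T (E : set T) (m : set (set X)) : Prop :=
  exists2 A, m A & E #< A.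

(** * Brauer graphs

   The vertex set X |_| X' is the type X + X, where [inl x] is the vertex x and
   [inr x] is the vertex x'. *)

Record brauer (X : Type) := Brauer {
  adj : X + X -> X + X -> Prop ;
  adj_sym : forall u v, adj u v -> adj v u ;
  adj_irr : forall u, ~ adj u u ;
  adj_deg : forall u v w, adj u v -> adj u w -> v = w }.

Lemma brauer_ext X (a b : brauer X) :
  (forall u v, adj a u v <-> adj b u v) -> a = b.
Proof.
case: a b => [r s i d] [r' s' i' d'] /= H.
have E : r = r' by apply/funext => u; apply/funext => v; apply/propext.
by subst r'; congr Brauer; apply: Prop_irrelevance.
Qed.

Section Product.
Variable X : Type.
Implicit Types a b : brauer X.

(** The vertex set of the product graph is (X |_| X') |_| X'': [inl u] is the
   vertex u of X |_| X' and [inr x] is x''. *)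
Definition rename_down (u : X + X) : (X + X) + X :=
  match u with inl x => inl (inl x) | inr x => inr x end.

Definition rename_up (u : X + X) : (X + X) + X :=
  match u with inl x => inr x | inr x => inl (inr x) end.

Definition adj_down a (p q : (X + X) + X) : Prop :=
  exists u v, [/\ adj a u v, p = rename_down u & q = rename_down v].

Definition adj_up b (p q : (X + X) + X) : Prop :=
  exists u v, [/\ adj b u v, p = rename_up u & q = rename_up v].

Definition product_graph a b (p q : (X + X) + X) : Prop :=
  adj_down a p q \/ adj_up b p q.

Definition mul_adj a b (u v : X + X) : Prop :=
  u <> v /\ clos_refl_sym_trans _ (product_graph a b) (inl u) (inl v).

Lemma rename_down_inj : injective rename_down.
Proof. by move=> [x|x] [y|y] //= [->]. Qed.

Lemma rename_up_inj : injective rename_up.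
Proof. by move=> [x|x] [y|y] //= [->]. Qed.

(** Edges of the product graph, coloured by the factor they come from. *)
Let col a b (c : bool) := if c then adj_up b else adj_down a.

Let col_sym a b c p q : col a b c p q -> col a b c q p.
Proof.
by case: c => -[u [v [/adj_sym h -> ->]]]; exists v, u.
Qed.

Let col_fun a b c p q r : col a b c p q -> col a b c p r -> q = r.
Proof.
case: c => -[u [v [h -> ->]]] [u' [v' [h' e ->]]].
  by move/rename_up_inj: e h' => <- /(adj_deg h) ->.
by move/rename_down_inj: e h' => <- /(adj_deg h) ->.
Qed.

Let outer (u : X + X) : bool := if u is inr _ then true else false.

Let col_outer a b c u q : col a b c (inl u) q -> c = outer u.
Proof.
by case: c u => -[x|x] [[y|y] [v [_ //= [e] _]]].
Qed.

(** [walk a b c p n q]: an alternating walk of length n from p to q whose first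
   edge has colour c; its next edge would have colour [col_next c n]. Vertices
   of X |_| X' meet edges of one colour only, so a component contains at most
   two of them. *)
Let col_next (c : bool) (n : nat) := odd n (+) c.

Let walk a b c p := fix walk (n : nat) (q : (X + X) + X) : Prop :=
  if n is m.+1 then exists2 r, walk m r & col a b (col_next c m) r q
  else p = q.

Let walk_fun a b c p n q r : walk a b c p n q -> walk a b c p n r -> q = r.
Proof.
elim: n q r => [|n IH] q r /=; first by move=> <-.
by move=> [q' /IH h hq] [r' /h e]; rewrite -e => /(col_fun hq).
Qed.

Let walk_prefix a b c p n k q :
  walk a b c p (n + k) q -> exists r, walk a b c p n r /\
  (k = 0 /\ r = q \/ exists r', col a b (col_next c n) r r').
Proof.
elim: k q => [|k IH] q; first by rewrite addn0 => h; exists q; split=> //; left.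
rewrite addnS /= => -[r /IH [r' [h1 [[k0 e]|h2]]] h3].
  by subst k r'; exists r; split=> //; right; exists q; rewrite addn0 in h3.
by exists r'; split=> //; right.
Qed.

Let walk_stop a b c p n u r : inl u <> p ->
  walk a b c p n (inl u) -> ~ col a b (col_next c n) (inl u) r.
Proof.
case: n => [|n] up /=; first by move=> e; case: up.
move=> [q _ /col_sym/col_outer h] /col_outer.
by rewrite -h /col_next /=; case: (odd n) c {h} => -[].
Qed.

Let walk_ends a b c p n m u v : inl u <> p -> inl v <> p ->
  walk a b c p n (inl u) -> walk a b c p m (inl v) -> u = v.
Proof.
wlog nm : n m u v / (n <= m)%N.
  move=> H hu hv wu wv; case/orP: (leq_total n m) => le.
    exact: (H n m).
  by symmetry; apply: (H m n).
move=> hu hv wu; rewrite -(subnKC nm) => /walk_prefix [r [wr]].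
rewrite (walk_fun wr wu) => -[[_ [//]]|[r' /(walk_stop hu wu)]//].
Qed.

Let walk_step a b u n p q k : walk a b (outer u) (inl u) n p ->
  col a b k p q -> exists m, walk a b (outer u) (inl u) m q.
Proof.
have [->|nk] := eqVneq k (col_next (outer u) n).
  by move=> h1 h2; exists n.+1; exists p.
case: n nk => [|n] nk /=.
  by move=> <- /col_outer e; rewrite e /col_next eqxx in nk.
move=> [r wr hr] hq; exists n.
have ek : k = col_next (outer u) n.
  by move: nk {hq}; rewrite /col_next /=; case: (odd n) (outer u) k => -[] [].
by rewrite ek in hq; rewrite (col_fun hq (col_sym hr)).
Qed.

Let walk_rst a b u p : clos_refl_sym_trans _ (product_graph a b) (inl u) p ->
  exists n, walk a b (outer u) (inl u) n p.
Proof.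
suff H q r : clos_refl_sym_trans _ (product_graph a b) q r ->
    (exists n, walk a b (outer u) (inl u) n q) <->
    (exists n, walk a b (outer u) (inl u) n r).
  by move/H => -[h _]; apply: h; exists 0.
have pk s t : product_graph a b s t -> exists k, col a b k s t.
  by case=> h; [exists false | exists true].
elim=> {q r} [q r /pk [k h]|//|q r _ [h1 h2]|q r s _ [h1 h2] _ [h3 h4]].
- split=> -[n w]; first exact: walk_step w h.
  exact: walk_step w (col_sym h).
- by split.
- by split=> [/h1|/h4].
Qed.

Lemma mul_adj_sym a b u v : mul_adj a b u v -> mul_adj a b v u.
Proof. by move=> [h1 h2]; split; [apply: nesym | apply: rst_sym]. Qed.

Lemma mul_adj_irr a b u : ~ mul_adj a b u u.
Proof. by case. Qed.

Lemma mul_adj_deg a b u v w :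
  mul_adj a b u v -> mul_adj a b u w -> v = w.
Proof.
move=> [uv /walk_rst [n wv]] [uw /walk_rst [m ww]].
by apply: walk_ends wv ww => -[e]; [apply: uv | apply: uw].
Qed.

Definition brauer_mul a b : brauer X :=
  Brauer (@mul_adj_sym a b) (@mul_adj_irr a b) (@mul_adj_deg a b).

Definition one_adj (u v : X + X) : Prop :=
  exists x, u = inl x /\ v = inr x \/ u = inr x /\ v = inl x.

Lemma one_adj_sym u v : one_adj u v -> one_adj v u.
Proof. by move=> [x [[-> ->]|[-> ->]]]; exists x; [right | left]. Qed.

Lemma one_adj_irr u : ~ one_adj u u.
Proof. by move=> [x [[->]|[->]]]. Qed.

Lemma one_adj_deg u v w : one_adj u v -> one_adj u w -> v = w.
Proof.
by move=> [x [[-> ->]|[-> ->]]] [y [[//= [->] ->]|[//= [->] ->]]].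
Qed.

Definition brauer_one : brauer X :=
  Brauer one_adj_sym one_adj_irr one_adj_deg.

End Product.

(** * The cardinal invariants t, h, h^*, s, s^*, as sets of edges or vertices *)

Section Invariants.
Variables (X : Type) (a : brauer X).

Definition transversals : set (set (X + X)) :=
  [set e | exists x y, adj a (inl x) (inr y) /\ e = [set inl x; inr y]].

Definition upper_hooks : set (set (X + X)) :=
  [set e | exists x y, adj a (inl x) (inl y) /\ e = [set inl x; inl y]].

Definition lower_hooks : set (set (X + X)) :=
  [set e | exists x y, adj a (inr x) (inr y) /\ e = [set inr x; inr y]].

Definition upper_singletons : set X :=
  [set x | forall v, ~ adj a (inl x) v].

Definition lower_singletons : set X :=
  [set x | forall v, ~ adj a (inr x) v].

End Invariants.

(** * Subsemigroups *)

Definition mul_closed X (S : set (brauer X)) : Prop :=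
  forall a b, S a -> S b -> S (brauer_mul a b).

Definition generated X (U : set (brauer X)) : set (brauer X) :=
  smallest (@mul_closed X) U.

Definition brauer_units X : set (brauer X) :=
  [set a | exists b, brauer_mul a b = brauer_one X /\
                     brauer_mul b a = brauer_one X].
Arguments brauer_units X : clear implicits.

Definition brauer_idempotents X : set (brauer X) :=
  [set a | brauer_mul a a = a].
Arguments brauer_idempotents X : clear implicits.

Definition FX X : set (brauer X) :=
  generated (brauer_idempotents X `|` brauer_units X).
Arguments FX X : clear implicits.

(** rank(S : A) = |K|: the minimum is attained at |K|. *)
Definition relative_rank_is X T (S A : set (brauer X)) (K : set T) : Prop :=
  (exists U, [/\ U `<=` S, S = generated (A `|` U) & U #= K]) /\
  (forall U, U `<=` S -> S = generated (A `|` U) -> K #<= U).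

Definition two_plus_two_rho X : set (nat + nat * set (set X)) :=
  card_add `I_2 (`I_2 `*` infinite_cardinals X).
Arguments two_plus_two_rho X : clear implicits.

Definition generating_pair X (m : set (set X)) (al be : brauer X) : Prop :=
  [/\ transversals al #= [set: X] /\ transversals be #= [set: X],
      has_card_lt (upper_singletons al) m /\ has_card (upper_hooks al) m,
      has_card_lt (upper_hooks be) m /\ has_card (upper_singletons be) m &
      [/\ has_card_lt (lower_singletons al) m, has_card (lower_hooks al) m,
          has_card_lt (lower_hooks be) m & has_card (lower_singletons be) m] \/
      [/\ has_card_lt (lower_hooks al) m, has_card (lower_singletons al) m,
          has_card_lt (lower_singletons be) m & has_card (lower_hooks be) m] ].

(* Main.v *)
(** Write F for the monoid of the graphs whose partial bijection
   [x |-> y] (for the transversals {x, y'}) extends to a permutation of X. It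
   contains the units and the idempotents: if e is idempotent and {x, y'} is a
   transversal with x <> y, then y is not in the domain and x is not in the
   codomain, so the partial bijection extends to an involution. The same swap
   in the middle row shows that F is closed under products. Conversely, up to a
   unit, an element of F has only transversals {x, x'}, and is then idempotent;
   hence F = F_X.

   For mu = 1 or mu infinite, the sets of fewer than mu elements form an ideal.
   If a product a b in F satisfies t = |X| and s < mu = h, then so does a
   factor: either h(a) = mu, or a has fewer than mu vertices outside its domain
   and outside its codomain, and then the upper hooks and singletons of b are
   those of a b up to fewer than mu. The same holds with s and h exchanged, and
   with lower for upper, so every generating set modulo the units contains one
   element of each of these types for each mu.

   Conversely, the invariants determine an element up to units. By induction on
   mu, the elements with fewer than mu vertices outside the domain are
   generated. An element of type alpha_mu is first multiplied by a displaced
   copy of itself, which duplicates its singletons; these can then be paired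
   off by multiplying with an element of smaller defect, since the copy removes
   the parity obstruction. This yields the elements with mu hooks and no
   singletons, and likewise those with mu singletons and no hooks, and these
   generate all elements with mu vertices outside the domain. *)
Require Import Defs.
From mathcomp Require Import all_boot.
From mathcomp Require Import boolp classical_sets functions cardinality.
From Stdlib Require Import Relation_Operators.
Local Open Scope classical_set_scope.
Local Open Scope card_scope.

Set Implicit Arguments.
Unset Strict Implicit.
Unset Printing Implicit Defensive.



(** * Cardinal arithmetic *)

(** A total relation that is injective into [B] suffices. Choice is applied here once, and later
    comparisons can use relations such as the transversals of a graph without naming a function. *)
Lemma card_le_rel T U (A : set T) (B : set U) (R : T -> U -> Prop) :
  (forall a, A a -> exists2 b, B b & R a b) ->
  (forall a a' b, A a -> A a' -> B b -> R a b -> R a' b -> a = a') ->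
  A #<= B.
Proof.
move=> tot inj.
have [->|/set0P[a0 Aa0]] := eqVneq A set0; first exact: card_ge0.
have [u0 _ _] := tot _ Aa0.
have /choice[f fP] : forall a, exists b, A a -> B b /\ R a b.
  move=> a; have [/tot[b Bb Rab]|nA] := pselect (A a); first by exists b.
  by exists u0.
elim/Ppointed: U => U in B R tot inj u0 f fP *; first by case: (no u0).
apply/pcard_leP/injfunPex; exists f; first by move=> a /fP[].
move=> a a' /set_mem Aa /set_mem Aa' e; have [Bf Rf] := fP _ Aa.
by apply: (inj _ _ (f a)) => //; rewrite e; apply: (fP _ Aa').2.
Qed.

Lemma card_le_fun T U (A : set T) (B : set U) (u0 : U) : A #<= B ->
  exists f : T -> U, (forall a, A a -> B (f a)) /\
    (forall a a', A a -> A a' -> f a = f a' -> a = a').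
Proof.
elim/Ppointed: U => U in B u0 *; first by case: (no u0).
move=> /pcard_leP/injfunPex[f fAB finj]; exists f; split=> // a a' Aa Aa' e.
by apply: finj => //; rewrite inE.
Qed.

Lemma card_eq_rel T U (A : set T) (B : set U) (R : T -> U -> Prop) :
  (forall a, A a -> exists2 b, B b & R a b) ->
  (forall b, B b -> exists2 a, A a & R a b) ->
  (forall a a' b, A a -> A a' -> B b -> R a b -> R a' b -> a = a') ->
  (forall a b b', A a -> B b -> B b' -> R a b -> R a b' -> b = b') ->
  A #= B.
Proof.
move=> t1 t2 i1 i2; rewrite card_eq_le; apply/andP; split.
  exact: card_le_rel t1 i1.
by apply: (card_le_rel (R := fun b a => R a b)) => // b b' a Bb Bb' Aa; apply: i2.
Qed.

Lemma card_eq_fun T U (A : set T) (B : set U) (u0 : U) : A #= B ->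
  exists f : T -> U, [/\ forall a, A a -> B (f a),
    forall a a', A a -> A a' -> f a = f a' -> a = a' &
    forall b, B b -> exists2 a, A a & f a = b].
Proof.
elim/Ppointed: U => U in B u0 *; first by case: (no u0).
move=> /pcard_eqP/bijPex[f [fAB finj fsurj]]; exists f; split.
- exact: fAB.
- by move=> a a' Aa Aa' e; apply: finj => //; rewrite inE.
- by move=> b /fsurj[a Aa <-]; exists a.
Qed.

Lemma card_eqW T U (A : set T) (B : set U) : A #= B -> A #<= B.
Proof. by rewrite card_eq_le => /andP[]. Qed.

(** Well-ordering of cardinals by Zorn's lemma. Take a maximal family [S] of functions choosing an
    element of each set in [C], any two of them different at every set of [C]. At some [A] the
    values of [S] exhaust [A], for otherwise one more function could be added; then [g A |-> g B]
    embeds [A] in every [B] of [C]. *)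
Lemma exists_card_min X (x0 : X) (C : set (set X)) : C !=set0 ->
  exists2 A, C A & forall B, C B -> A #<= B.
Proof.
move=> [A0 CA0].
pose P (S : set (set X -> X)) :=
  (forall g B, S g -> C B -> B (g B)) /\
  (forall g g' B, S g -> S g' -> C B -> g B = g' B -> g = g').
have [|S [[S1 S2] Smax]] := @Zorn_bigcup _ P.
  move=> F FP Ftot; split=> [g B [S /FP[S1 _] Sg] CB|]; first exact: (S1 g B).
  move=> g g' B [S FS Sg] [S' FS' Sg'] CB.
  have [sub|sub] := Ftot _ _ FS FS'.
    by apply: ((FP _ FS').2 g g' B) => //; apply: sub.
  by apply: ((FP _ FS).2 g g' B) => //; apply: sub.
have [[A [CA hit]]|nhit] :=
    pselect (exists A, C A /\ forall a, A a -> exists2 g, S g & g A = a).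
  exists A => // B CB; apply: (@card_le_trans _ _ _ S).
    apply: (card_le_rel (R := fun a g => g A = a)) => //.
    by move=> a a' g _ _ _ <- <-.
  apply: (card_le_rel (R := fun g b => g B = b)).
    by move=> g Sg; exists (g B) => //; apply: (S1 g B).
  by move=> g g' b Sg Sg' Bb <- /esym; apply: (S2 g g' B).
have /choice[g gP] : forall A, exists a,
    C A -> A a /\ forall g, S g -> g A <> a.
  move=> A; have [CA|nCA] := pselect (C A); last by exists x0.
  apply: contrapT => H; apply: nhit; exists A; split=> // a Aa.
  apply: contrapT => H'; apply: H; exists a => _; split=> // g Sg e.
  by apply: H'; exists g.
exfalso; apply: (Smax (S `|` [set g])).
  split; first by move=> h Sh; left.
  move=> /(_ g (or_intror erefl)) Sg.
  by have [_ /(_ _ Sg)] := gP _ CA0.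
split=> [h B [Sh|->] CB|h h' B]; [exact: (S1 h B)|exact: (gP _ CB).1|].
move=> [Sh|->] [Sh'|->] CB e //; first exact: (S2 _ _ B).
  by have [_ /(_ _ Sh)] := gP _ CB.
by have [_ /(_ _ Sh')] := gP _ CB; rewrite e.
Qed.

Lemma card_image_inj T U (f : T -> U) (A : set T) : injective f -> f @` A #= A.
Proof. by move=> finj; apply: inj_card_eq => x y _ _; apply: finj. Qed.

(** Comparability is the existence of a minimum for two sets, which are first copied into the common
    type [T + U]. *)
Lemma card_le_total T U (A : set T) (B : set U) : A #<= B \/ B #<= A.
Proof.
have [->|/set0P[a0 _]] := eqVneq A set0; first by left; exact: card_ge0.
have iA : (@inl T U) @` A #= A by apply: card_image_inj => ? ? [].
have iB : (@inr T U) @` B #= B by apply: card_image_inj => ? ? [].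
have [|C [->|->] Cmin] := @exists_card_min _ (inl a0 : T + U)
    [set inl @` A; inr @` B]; first by exists (inl @` A); left.
  left; rewrite -(card_le_eql iA) -(card_le_eqr iB).
  by apply: Cmin; right.
right; rewrite -(card_le_eql iB) -(card_le_eqr iA).
by apply: Cmin; left.
Qed.

(* A maximal family of pairwise disjoint sequences in [A] leaves out finitely
   many elements of [A], and shifting the terms of the sequences makes room for
   these and for a second copy of the rest. *)
Lemma card_infinite_double T (A : set T) : infinite_set A ->
  A `*` [set: bool] #= A.
Proof.
move=> infA.
pose P (S : set (nat -> T)) := (forall f n, S f -> A (f n)) /\
  (forall f g n m, S f -> S g -> f n = g m -> f = g /\ n = m).
have [|S [[S1 S2] Smax]] := @Zorn_bigcup _ P.
  move=> F FP Ftot; split=> [f n [S /FP[SA _] /SA]//|].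
  move=> f g n m [S FS Sf] [S' FS' Sg].
  have [sub|sub] := Ftot _ _ FS FS'.
    by apply: (FP _ FS').2 => //; apply: sub.
  by apply: (FP _ FS).2 => //; apply: sub.
pose W := [set x | exists f n, S f /\ f n = x].
have finZ : finite_set (A `\` W).
  apply/finite_setPn => leZ.
  have [a0 _] : A !=set0 by apply: infinite_setN0.
  have [f [fZ finj]] := card_le_fun a0 leZ.
  apply: (Smax (S `|` [set f])).
    split; first by move=> h Sh; left.
    move=> /(_ f (or_intror erefl)) Sf.
    by have [_] := fZ 0 I; apply; exists f, 0.
  split=> [g n [Sg|->]|g h n m]; [exact: S1|by have [] := fZ n I|].
  move=> [Sg|->] [Sh|->] e; first exact: S2.
  - by have [_] := fZ m I; case; exists g, n.
  - by have [_] := fZ n I; case; exists h, m.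
  - by split=> //; apply: finj.
have [f0 Sf0] : S !=set0.
  apply/set0P/negP => /eqP S0; apply: infA.
  suff -> : A = A `\` W by [].
  by apply/seteqP; split=> [a Aa|a []//]; split=> // -[f [n []]]; rewrite S0.
have [i [_ iinj]] := card_le_fun 0 (finite_set_countable finZ).
(* Terms of the sequences move to even positions; the finitely many elements outside [W], numbered
   by [i], go to odd positions of the single sequence [f0]. *)
have leW : A #<= W.
  apply: (card_le_rel (R := fun a b =>
    (exists f n, [/\ S f, f n = a & f n.*2 = b]) \/
    [/\ ~ W a & f0 (i a).*2.+1 = b])).
    move=> a Aa; have [[f [n [Sf e]]]|nWa] := pselect (W a).
      by exists (f n.*2); [exists f, n.*2|left; exists f, n].
    by exists (f0 (i a).*2.+1); [exists f0, (i a).*2.+1|right].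
  move=> a a' b Aa Aa' _.
  case=> [[f [n [Sf <- <-]]]|[nW <-]] [[g [m [Sg <-]]]|[nW']].
  - by move/(S2 _ _ _ _ Sg Sf) => [-> /double_inj ->].
  - by move/(S2 _ _ _ _ Sf0 Sf) => [_ /(congr1 odd)]; rewrite /= !odd_double.
  - by move/(S2 _ _ _ _ Sg Sf0) => [_ /(congr1 odd)]; rewrite /= !odd_double.
  - move/(S2 _ _ _ _ Sf0 Sf0) => [_ [/double_inj e]].
    by apply/esym; apply: iinj.
(* The pair of [f n] and a bit [c] goes to [f (c + 2n)]. *)
have leWb : W `*` [set: bool] #<= W.
  apply: (card_le_rel (R := fun (p : T * bool) b =>
    exists f n, [/\ S f, f n = p.1 & f (p.2 + n.*2)%N = b])).
    move=> [_ c] [[f [n [Sf <-]]] _] /=.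
    by exists (f (c + n.*2)%N); [exists f, (c + n.*2)%N|exists f, n].
  move=> [a c] [a' c'] b _ _ _ [f [n [Sf /= <- <-]]] [g [m [Sg /= <-]]].
  move=> /(S2 _ _ _ _ Sg Sf)[-> e].
  have ec : c' = c.
    by move/(congr1 odd): e; rewrite !oddD !odd_double !addbF !oddb.
  by move: e; rewrite ec => /addnI/double_inj ->.
rewrite card_eq_le; apply/andP; split; last first.
  apply: (card_le_rel (R := fun a p => p = (a, true))).
    by move=> a Aa; exists (a, true).
  by move=> a a' p _ _ _ -> [].
apply: (@card_le_trans _ _ _ (W `*` [set: bool])).
  have [a0 _] : A !=set0 by apply: infinite_setN0.
  have [h [hW hinj]] := card_le_fun a0 leW.
  apply: (card_le_rel (R := fun p q => q = (h p.1, p.2))).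
    by move=> [a c] [/= Aa _]; exists (h a, c) => //; split=> //; apply: hW.
  by move=> [a c] [a' c'] p [/= Aa _] [/= Aa' _] _ -> [/hinj -> // ->].
apply: (card_le_trans leWb); apply: subset_card_le => x [f [n [Sf <-]]].
exact: S1.
Qed.

Lemma card_le_setU T U (A B : set T) (C : set U) : infinite_set C ->
  A #<= C -> B #<= C -> A `|` B #<= C.
Proof.
move=> infC leA leB; have [c0 _] : C !=set0 by apply: infinite_setN0.
have [f [fC finj]] := card_le_fun c0 leA.
have [g [gC ginj]] := card_le_fun c0 leB.
rewrite -(card_le_eqr (card_infinite_double infC)).
apply: (card_le_rel (R := fun x p =>
  (A x /\ p = (f x, true)) \/ [/\ ~ A x, B x & p = (g x, false)])).
  move=> x; have [Ax _|nAx [//|Bx]] := pselect (A x).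
    by exists (f x, true); [split=> //; apply: fC|left].
  by exists (g x, false); [split=> //; apply: gC|right].
move=> x y p _ _ _ [[Ax ->]|[_ Bx ->]] [[Ay]|[_ By]] // [].
  exact: finj.
exact: ginj.
Qed.

Lemma card_infinite_split T (A : set T) : infinite_set A ->
  exists B C, [/\ A = B `|` C, B `&` C = set0, B #= A & C #= A].
Proof.
move=> infA; have [a0 _] : A !=set0 by apply: infinite_setN0.
have [f [fA finj fsurj]] := card_eq_fun a0 (card_infinite_double infA).
have half c : [set f (x, c) | x in A] #= A.
  by apply: inj_card_eq => x y /set_mem Ax /set_mem Ay /(finj (x, c) (y, c) (conj Ax I) (conj Ay I))[].
exists [set f (x, true) | x in A], [set f (x, false) | x in A]; split=> //.
- apply/seteqP; split=> [a /fsurj[[x []] [/= Ax _] <-]|a [] [x Ax <-]].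
  + by left; exists x.
  + by right; exists x.
  + by apply: fA.
  + by apply: fA.
- rewrite -subset0 => a [[x Ax <-] [y Ay]].
  by move=> /(finj (y, false) (x, true) (conj Ay I) (conj Ax I)).
Qed.

Lemma infinite_card_le T U (A : set T) (B : set U) :
  infinite_set A -> A #<= B -> infinite_set B.
Proof. by move=> infA le fin; apply: infA; apply: card_le_finite le fin. Qed.

Lemma card_eq_infinite T U (A : set T) (B : set U) :
  A #= B -> infinite_set A -> infinite_set B.
Proof. by move=> /card_eqW le infA; apply: infinite_card_le le. Qed.

(** If [C] were finite, so would be [B] and hence [A]; an infinite [C] absorbs the smaller piece
    [B]. *)
Lemma card_setU_infinite T (A B C : set T) : infinite_set A -> A = B `|` C ->
  B #<= C -> C #= A.
Proof.
move=> infA eA le; rewrite card_eq_le; apply/andP; split.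
  by apply: subset_card_le; rewrite eA; right.
have infC : infinite_set C.
  move=> finC; apply: infA; rewrite eA finite_setU; split=> //.
  exact: card_le_finite le finC.
by rewrite eA; apply: card_le_setU.
Qed.

Lemma card_lt_le T U (A : set T) (B : set U) : A #< B -> A #<= B.
Proof. by case. Qed.

Lemma card_le_lt_trans T U V (A : set T) (B : set U) (C : set V) :
  A #<= B -> B #< C -> A #< C.
Proof.
move=> leAB [leBC nBC]; split; first exact: card_le_trans leBC.
move=> eAC; apply: nBC; rewrite card_eq_le leBC /=.
by rewrite -(card_le_eql eAC).
Qed.

Lemma card_lt_le_trans T U V (A : set T) (B : set U) (C : set V) :
  A #< B -> B #<= C -> A #< C.
Proof.
move=> [leAB nAB] leBC; split; first exact: card_le_trans leBC.
move=> eAC; apply: nAB; rewrite card_eq_le leAB /=.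
by rewrite (card_le_eqr eAC).
Qed.

Lemma card_ltNge T U (A : set T) (B : set U) : A #< B <-> ~ (B #<= A).
Proof.
split=> [[le ne] le'|nle]; first by apply: ne; rewrite card_eq_le le.
have [le|//] := card_le_total A B; split=> // e.
by apply: nle; apply: card_eqW; rewrite card_eq_sym.
Qed.

Lemma card_le_anti T U (A : set T) (B : set U) :
  A #<= B -> ~ (A #< B) -> A #= B.
Proof. by move=> le nlt; apply: contrapT => ne; apply: nlt. Qed.

(* Smallness is an ideal for an infinite cardinal and for the cardinal one. *)
Definition additive_card T (A : set T) := infinite_set A \/ A #= [set: unit].

Lemma card_lt_unit T U (A : set T) (B : set U) :
  B #= [set: unit] -> A #< B -> A = set0.
Proof.
move=> e1 lt; apply: contrapT => /eqP/set0P[a Aa].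
move: lt => /card_ltNge; apply.
rewrite (card_le_eql e1); apply: (card_le_rel (R := fun _ _ => True)).
  by move=> _ _; exists a.
by move=> [] [].
Qed.

(** For the cardinal one both sets are empty. For an infinite [C], a union as large as [C] would be
    equinumerous with the larger of its two parts. *)
Lemma card_lt_setU T U (A B : set T) (C : set U) : additive_card C ->
  A #< C -> B #< C -> A `|` B #< C.
Proof.
move=> [infC|C1] ltA ltB; last first.
  rewrite (card_lt_unit C1 ltA) (card_lt_unit C1 ltB) setU0.
  by rewrite -(card_lt_unit C1 ltA).
apply/card_ltNge => le.
wlog leAB : A B ltA ltB le / A #<= B.
  move=> H; have [leAB|leBA] := card_le_total A B; first exact: (H A B).
  by apply: (H B A) => //; rewrite setUC.
have infAB : infinite_set (A `|` B) by apply: infinite_card_le le.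
have e := card_setU_infinite infAB erefl leAB.
by move: ltB => /card_ltNge; apply; rewrite (card_le_eqr e).
Qed.

Lemma card_lt_sub T U (A B : set T) (C : set U) : A `<=` B -> B #< C -> A #< C.
Proof. by move=> /subset_card_le; exact: card_le_lt_trans. Qed.

Lemma card_lt_image T U V (f : T -> U) (A : set T) (C : set V) :
  A #< C -> f @` A #< C.
Proof. exact/card_le_lt_trans/card_image_le. Qed.

Lemma card_lt_set0 T U (C : set U) : C !=set0 -> @set0 T #< C.
Proof.
move=> [c Cc]; split; first exact: card_ge0.
by rewrite card_eq_sym card_eq0 => /eqP C0; rewrite C0 in Cc.
Qed.

Lemma additive_card_neq0 T (A : set T) : additive_card A -> A !=set0.
Proof.
move=> [/infinite_setN0//|A1]; apply/set0P/negP => /eqP A0.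
by move: A1; rewrite A0 card_eq_sym card_eq0 => /eqP/seteqP[/(_ tt I)].
Qed.

Lemma card_ind X (x0 : X) (P : set X -> Prop) :
  (forall A, (forall B, B #< A -> P B) -> P A) -> forall A, P A.
Proof.
move=> IH A; apply: contrapT => nPA.
have [|B nPB Bmin] := @exists_card_min _ x0 [set A | ~ P A]; first by exists A.
by apply: nPB; apply: IH => C /card_ltNge ltC; apply: contrapT => /Bmin.
Qed.


(** * Products of Brauer graphs *)

Section Basics.
Variable X : Type.
Implicit Types (a b c : brauer X) (x y z : X) (u v w : X + X).

Definition up a x y := adj a (inl x) (inl y).
Definition tr a x y := adj a (inl x) (inr y).
Definition lo a x y := adj a (inr x) (inr y).

Definition dom a : set X := [set x | exists y, tr a x y].
Definition cod a : set X := [set y | exists x, tr a x y].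

Lemma brauer_eq a b : (forall x y, up a x y <-> up b x y) ->
  (forall x y, tr a x y <-> tr b x y) ->
  (forall x y, lo a x y <-> lo b x y) -> a = b.
Proof.
move=> U T L; apply: brauer_ext => -[x|x] [y|y].
- exact: U.
- exact: T.
- by split=> /adj_sym/T/adj_sym.
- exact: L.
Qed.

Lemma tr_fun a x y z : tr a x y -> tr a x z -> y = z.
Proof. by move=> h /(adj_deg h)[]. Qed.

Lemma tr_inj a x y z : tr a x z -> tr a y z -> x = y.
Proof. by move=> /adj_sym h /adj_sym /(adj_deg h)[]. Qed.

Lemma up_tr a x y z : up a x y -> tr a x z -> False.
Proof. by move=> h /(adj_deg h). Qed.

Lemma lo_tr a x y z : lo a x y -> tr a z x -> False.
Proof. by move=> h /adj_sym /(adj_deg h). Qed.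

Definition flip u : X + X := match u with inl x => inr x | inr x => inl x end.

Lemma flipK : involutive flip. Proof. by case. Qed.

Lemma star_sym a u v : adj a (flip u) (flip v) -> adj a (flip v) (flip u).
Proof. exact: adj_sym. Qed.
Lemma star_irr a u : ~ adj a (flip u) (flip u).
Proof. exact: adj_irr. Qed.
Lemma star_deg a u v w :
  adj a (flip u) (flip v) -> adj a (flip u) (flip w) -> v = w.
Proof. by move=> h /(adj_deg h)/(can_inj flipK). Qed.

(** Reflection exchanging the two rows. It reverses products ([star_mul]), so each statement on
    lower vertices reduces to one on upper vertices. *)
Definition star a := Brauer (@star_sym a) (@star_irr a) (@star_deg a).

Lemma starK : involutive star.
Proof. by move=> a; apply: brauer_ext => u v; rewrite /= !flipK. Qed.

Definition flip3 (p : (X + X) + X) : (X + X) + X :=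
  match p with inl u => inl (flip u) | inr x => inr x end.

Lemma flip3_rst a b p q : clos_refl_sym_trans _ (product_graph a b) p q ->
  clos_refl_sym_trans _ (product_graph (star b) (star a)) (flip3 p) (flip3 q).
Proof.
elim=> {p q} [p q H|p|p q _|p q r _ h1 _ h2].
- apply: rst_step; case: H => -[u [v [h -> ->]]]; [right|left];
    exists (flip u), (flip v); rewrite /= !flipK; split=> //.
  + by case: u {h}.
  + by case: v {h}.
  + by case: u {h}.
  + by case: v {h}.
- exact: rst_refl.
- exact: rst_sym.
- exact: rst_trans h2.
Qed.

Lemma star_mul a b : star (brauer_mul a b) = brauer_mul (star b) (star a).
Proof.
apply: brauer_ext => u v; split=> -[uv h].
  split; first by move=> e; apply: uv; rewrite e.
  by have := flip3_rst h; rewrite /= !flipK.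
split; first by move=> /(can_inj flipK).
by have := flip3_rst h; rewrite /= !starK.
Qed.

Lemma product_downP a b u v : adj a u v ->
  clos_refl_sym_trans _ (product_graph a b) (rename_down u) (rename_down v).
Proof. by move=> h; apply: rst_step; left; exists u, v. Qed.

Lemma product_upP a b u v : adj b u v ->
  clos_refl_sym_trans _ (product_graph a b) (rename_up u) (rename_up v).
Proof. by move=> h; apply: rst_step; right; exists u, v. Qed.

Lemma mul_up a b x y : up a x y -> up (brauer_mul a b) x y.
Proof.
move=> h; split; first by move=> [e]; move: h; rewrite e => /adj_irr.
exact: product_downP h.
Qed.

Lemma mul_tr a b x y z : tr a x y -> tr b y z -> tr (brauer_mul a b) x z.
Proof.
move=> h1 h2; split=> //; apply: rst_trans (product_downP b h1) _.
exact: (product_upP a h2).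
Qed.

Lemma mul_up2 a b x y x' y' : tr a x x' -> up b x' y' -> tr a y y' ->
  up (brauer_mul a b) x y.
Proof.
move=> h1 h2 h3; split.
  by move=> [e]; move: h2; rewrite e in h1; rewrite (tr_fun h1 h3) => /adj_irr.
apply: rst_trans (product_downP b h1) _.
apply: rst_trans (product_upP a h2) _.
by apply: rst_sym; apply: (product_downP b h3).
Qed.

Lemma mul_lo a b x y : lo b x y -> lo (brauer_mul a b) x y.
Proof.
move=> h; rewrite -[brauer_mul a b]starK star_mul.
exact: (@mul_up (star b) (star a)).
Qed.

Lemma mul_lo2 a b x y x' y' : tr b x x' -> lo a x y -> tr b y y' ->
  lo (brauer_mul a b) x' y'.
Proof.
move=> h1 h2 h3; rewrite -[brauer_mul a b]starK star_mul.
by apply: (@mul_up2 (star b) (star a) x' y' x y) => //; apply: adj_sym.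
Qed.

(** A set [K] closed under adjacency contains the whole component of [u]; when [u] is its only
    vertex outside the middle row, nothing is left for [u] to be joined to. *)
Lemma mul_isolated a b u (K : set ((X + X) + X)) : K (inl u) ->
  (forall p q, product_graph a b p q -> K p -> K q) ->
  (forall v, K (inl v) -> v = u) ->
  forall v, ~ adj (brauer_mul a b) u v.
Proof.
move=> Ku Kcl K1 v [uv h]; apply: uv; apply/esym; apply: K1.
suff H p q : clos_refl_sym_trans _ (product_graph a b) p q -> (K p <-> K q).
  exact/(H _ _ h).
elim=> {p q} [p q {}h|//|p q _ [h1 h2]|p q r _ [h1 h2] _ [h3 h4]].
- split; first exact: Kcl.
  apply: Kcl; case: h => -[s [t [/adj_sym h -> ->]]]; [left|right];
  by exists t, s.
- by split.
- by split=> [/h1|/h4].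
Qed.

Lemma mul_up_isolated a b x : (forall v, ~ adj a (inl x) v) ->
  forall v, ~ adj (brauer_mul a b) (inl x) v.
Proof.
move=> H; apply: (@mul_isolated _ _ _ [set inl (inl x)]) => //.
  move=> p q [] [u [v [h -> ->]]] /=; first by case: u h => // y + [e]; subst y => /H.
  by case: u h.
by move=> v /= [].
Qed.

Lemma mul_up_isolated2 a b x y : tr a x y -> (forall v, ~ adj b (inl y) v) ->
  forall v, ~ adj (brauer_mul a b) (inl x) v.
Proof.
move=> h1 H; apply: (@mul_isolated _ _ _ [set inl (inl x); inr y]).
- by left.
- move=> p q [] [u [v [h -> ->]]] [] /=; case: u h => // z h [e]; subst z.
  + by right; rewrite -(adj_deg h1 h).
  + by left; rewrite -(adj_deg (adj_sym h1) h).
  + by have := H _ h.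
- by move=> v /= [[->]|].
Qed.

Lemma mul_lo_isolated a b x : (forall v, ~ adj b (inr x) v) ->
  forall v, ~ adj (brauer_mul a b) (inr x) v.
Proof.
move=> H v h; apply: (@mul_up_isolated (star b) (star a) x _ (flip v)).
  by move=> w /=; apply: H.
by rewrite -star_mul /= flipK.
Qed.

Lemma mul_lo_isolated2 a b x y : tr b y x -> (forall v, ~ adj a (inr y) v) ->
  forall v, ~ adj (brauer_mul a b) (inr x) v.
Proof.
move=> h1 H v h; apply: (@mul_up_isolated2 (star b) (star a) x y _ _ (flip v)).
- exact: adj_sym.
- by move=> w /=; apply: H.
- by rewrite -star_mul /= flipK.
Qed.

(** It is enough to find the edges of [c] in the product and to see that its singletons stay
    isolated: degree at most one excludes all other edges, so components need not be described in
    full. *)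
Lemma mul_eq a b c :
  (forall u v, adj c u v -> adj (brauer_mul a b) u v) ->
  (forall u, (forall v, ~ adj c u v) ->
     forall v, ~ adj (brauer_mul a b) u v) ->
  brauer_mul a b = c.
Proof.
move=> H1 H2; apply: brauer_ext => u v; split=> [h|]; last exact: H1.
have [[w hw]|nw] := pselect (exists w, adj c u w).
  by rewrite (adj_deg h (H1 _ _ hw)).
by case: (H2 u _ v h) => w hw; apply: nw; exists w.
Qed.

Lemma vertex_cases a x :
  [\/ exists y, tr a x y, exists y, up a x y | forall v, ~ adj a (inl x) v].
Proof.
have [[[y|y] h]|n] := pselect (exists v, adj a (inl x) v).
- by apply: Or32; exists y.
- by apply: Or31; exists y.
- by apply: Or33 => v h; apply: n; exists v.
Qed.

(** A vertex on an upper hook of [a], or an upper singleton of [a], keeps this role in the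
    product. *)
Lemma mul_dom a b x y : tr (brauer_mul a b) x y -> dom a x.
Proof.
move=> h; have [//|[z /(mul_up b) hz]|/mul_up_isolated n] := vertex_cases a x.
  by case: (up_tr hz h).
by case: (n _ _ h).
Qed.

Lemma tr_star a x y : tr (star a) x y <-> tr a y x.
Proof. by split=> /adj_sym. Qed.

Lemma mul_cod a b x y : tr (brauer_mul a b) x y -> cod b y.
Proof.
move=> /tr_star; rewrite star_mul => /mul_dom[z /tr_star h].
by exists z.
Qed.

(** ** Relabelling and units *)

Section Relabel.
Variables (a : brauer X) (f : X + X -> X + X) (finj : injective f).
Lemma relabel_sym u v : adj a (f u) (f v) -> adj a (f v) (f u).
Proof. exact: adj_sym. Qed.
Lemma relabel_irr u : ~ adj a (f u) (f u).
Proof. exact: adj_irr. Qed.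
Lemma relabel_deg u v w : adj a (f u) (f v) -> adj a (f u) (f w) -> v = w.
Proof. by move=> h /(adj_deg h)/finj. Qed.
Definition relabel := Brauer relabel_sym relabel_irr relabel_deg.
End Relabel.

Definition up_map (f : X -> X) u : X + X :=
  match u with inl x => inl (f x) | inr x => inr x end.

Lemma up_map_inj f : injective f -> injective (up_map f).
Proof. by move=> finj [x|x] [y|y] //= [e]; rewrite (e, finj _ _ e). Qed.

(** The inverse is part of the data, since relabelling the lower row uses it explicitly. *)
Record permutation := Permutation {
  pfun :> X -> X; pback : X -> X; pfunK : cancel pfun pback;
  pbackK : cancel pback pfun }.
Implicit Types f : permutation.

Definition perm_inv f := Permutation (@pbackK f) (@pfunK f).

Lemma pfun_inj f : injective f. Proof. exact: can_inj (@pfunK f). Qed.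

Definition perm_elt f : brauer X :=
  relabel (brauer_one X) (up_map_inj (@pfun_inj f)).

Lemma tr_perm f x y : tr (perm_elt f) x y <-> y = f x.
Proof.
split=> [[z [[[e] [e']]|[//]]]|->]; first by rewrite e e'.
by exists (f x); left.
Qed.

Lemma up_perm f x y : ~ up (perm_elt f) x y.
Proof. by move=> [z [[]|[]]]. Qed.

Lemma lo_perm f x y : ~ lo (perm_elt f) x y.
Proof. by move=> [z [[]|[]]]. Qed.

Lemma star_perm f : star (perm_elt f) = perm_elt (perm_inv f).
Proof.
apply: brauer_eq => x y.
- by split=> [/lo_perm|/up_perm].
- split=> [/tr_star/tr_perm ->|/tr_perm ->].
    by apply/tr_perm; rewrite /= pfunK.
  by apply/tr_star/tr_perm; rewrite /= pbackK.
- by split=> [/up_perm|/lo_perm].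
Qed.

Lemma mul_perml f a :
  brauer_mul (perm_elt f) a = relabel a (up_map_inj (@pfun_inj f)).
Proof.
have trf x : tr (perm_elt f) x (f x) by apply/tr_perm.
apply: mul_eq => [[x|x] [y|y] /= h|[x|x] H].
- exact: mul_up2 (trf x) h (trf y).
- exact: mul_tr (trf x) h.
- by apply: mul_adj_sym; apply: mul_tr (trf y) (adj_sym h).
- exact: mul_lo.
- by apply: (mul_up_isolated2 (trf x)) => v h; case: v h => [y|y] h;
    [apply: (H (inl (pback f y))); rewrite /= pbackK|apply: (H (inr y))].
- by apply: mul_lo_isolated => v h; case: v h => [y|y] h;
    [apply: (H (inl (pback f y))); rewrite /= pbackK|apply: (H (inr y))].
Qed.

Lemma up_perml f a x y : up (brauer_mul (perm_elt f) a) x y <-> up a (f x) (f y).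
Proof. by rewrite mul_perml. Qed.
Lemma tr_perml f a x y : tr (brauer_mul (perm_elt f) a) x y <-> tr a (f x) y.
Proof. by rewrite mul_perml. Qed.
Lemma lo_perml f a x y : lo (brauer_mul (perm_elt f) a) x y <-> lo a x y.
Proof. by rewrite mul_perml. Qed.

Lemma mul_permrE f a : brauer_mul a (perm_elt f) =
  star (brauer_mul (perm_elt (perm_inv f)) (star a)).
Proof. by rewrite star_mul starK -star_perm starK. Qed.

Lemma up_permr f a x y : up (brauer_mul a (perm_elt f)) x y <-> up a x y.
Proof. by rewrite mul_permrE mul_perml. Qed.
Lemma tr_permr f a x y :
  tr (brauer_mul a (perm_elt f)) x y <-> tr a x (pback f y).
Proof. by rewrite mul_permrE mul_perml. Qed.
Lemma lo_permr f a x y :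
  lo (brauer_mul a (perm_elt f)) x y <-> lo a (pback f x) (pback f y).
Proof. by rewrite mul_permrE mul_perml. Qed.

Lemma mul_permlK f a :
  brauer_mul (perm_elt f) (brauer_mul (perm_elt (perm_inv f)) a) = a.
Proof.
rewrite !mul_perml; apply: brauer_ext.
by move=> [x|x] [y|y] /=; rewrite ?pfunK.
Qed.

Lemma mul_permrK f a :
  brauer_mul (brauer_mul a (perm_elt f)) (perm_elt (perm_inv f)) = a.
Proof.
apply: (can_inj (@starK)).
by rewrite !star_mul !star_perm mul_permlK.
Qed.

Lemma perm_elt_unit f : brauer_units X (perm_elt f).
Proof.
exists (perm_elt (perm_inv f)).
split; apply: brauer_eq => x y;
  rewrite ?up_perml ?tr_perml ?lo_perml; split.
- by move/up_perm.
- by move=> [z [[]|[]]].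
- by move/tr_perm => -> /=; rewrite pfunK; exists x; left.
- by move=> [z [[[->] [->]]|[]//]]; apply/tr_perm; rewrite /= pfunK.
- by move/lo_perm.
- by move=> [z [[]|[]]].
- by move/up_perm.
- by move=> [z [[]|[]]].
- by move/tr_perm => -> /=; rewrite pbackK; exists x; left.
- by move=> [z [[[->] [->]]|[]//]]; apply/tr_perm; rewrite /= pbackK.
- by move/lo_perm.
- by move=> [z [[]|[]]].
Qed.

Lemma tr_one x : tr (brauer_one X) x x. Proof. by exists x; left. Qed.

(** By [mul_dom] and [mul_cod] a unit has every vertex in its domain and in its codomain, so its
    transversals form a permutation and leave no room for hooks. *)
Lemma unitP a : brauer_units X a <-> exists f, a = perm_elt f.
Proof.
split=> [[b [ab ba]]|[f ->]]; last exact: perm_elt_unit.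
have da x : dom a x by apply: (@mul_dom _ b _ x); rewrite ab; apply: tr_one.
have ca x : cod a x by apply: (@mul_cod b _ x x); rewrite ba; apply: tr_one.
have /choice[f fP] := da; have /choice[g gP] := ca.
have fK : cancel f g by move=> x; apply: tr_inj (gP _) (fP _).
have gK : cancel g f by move=> x; apply: tr_fun (fP _) (gP _).
exists (Permutation fK gK); apply: brauer_eq => x y; split.
- by move/up_tr/(_ (fP x)).
- by move/up_perm.
- by move=> h; apply/tr_perm; apply: tr_fun h (fP _).
- by move/tr_perm => ->; apply: fP.
- by move/lo_tr/(_ (gP x)).
- by move/lo_perm.
Qed.

End Basics.


(** * Elements whose transversals extend to a permutation *)

Section Extendable.
Variable X : Type.
Implicit Types (a b c : brauer X) (x y z : X) (A B : set X).

Definition extendable a :=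
  exists f : permutation X, forall x y, tr a x y -> y = f x.

(** The extension is an involution: a point moves along [R] if it can, otherwise back along [R],
    otherwise it stays. The third hypothesis makes these rules consistent. *)
Lemma swap_extension (R : X -> X -> Prop) :
  (forall x y z, R x y -> R x z -> y = z) ->
  (forall x y z, R x z -> R y z -> x = y) ->
  (forall x y, R x y -> x = y \/
     (forall z, ~ R z x) /\ (forall z, ~ R y z)) ->
  exists f : permutation X, forall x y, R x y -> y = f x.
Proof.
move=> Rfun Rinj Rswap.
pose S x y := R x y \/ (forall z, ~ R x z) /\
  (R y x \/ y = x /\ (forall z, ~ R z x)).
have /choice[f fP] : forall x, exists y, S x y.
  move=> x; have [[y Rxy]|n1] := pselect (exists y, R x y).
    by exists y; left.
  have n1' z : ~ R x z by move=> h; apply: n1; exists z.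
  have [[y Ryx]|n2] := pselect (exists y, R y x).
    by exists y; right; split=> //; left.
  exists x; right; split=> //; right; split=> // z h.
  by apply: n2; exists z.
have Rf x y : R x y -> y = f x.
  by move=> h; case: (fP x) => [|[n _]]; [apply: Rfun|case: (n y)].
have Rf' x y : R x y -> x = f y.
  move=> h; case: (fP y) => [h'|[_ [h'|[_ n]]]].
  - have [e|[_ n]] := Rswap _ _ h; last by case: (n _ h').
    by rewrite -e in h *; apply: Rf.
  - exact: Rinj h h'.
  - by case: (n x).
have fK : involutive f.
  move=> x; case: (fP x) => [/Rf'/esym//|[_ [/Rf/esym//|[e _]]]].
  by rewrite !e.
by exists (Permutation fK fK).
Qed.

Lemma extendable_mul : mul_closed extendable.
Proof.
move=> a b [f fP] [g gP].
(* [R] relates the vertex [y] where a transversal of the product leaves [a] to the vertex [w] where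
   it enters [b]. If they differ, [y] is not in [dom b] and [w] is not in [cod a], so [R] extends to
   a permutation [h] of the middle row, and [f], [h], [g] are composed. *)
pose R y w := exists x z, [/\ tr a x y, tr b w z & tr (brauer_mul a b) x z].
have [|||h hP] := @swap_extension R.
- move=> y w w' [x [z [h1 h2 h3]]] [x' [z' [h1' h2' h3']]].
  move: h3'; rewrite -(tr_inj h1 h1') => /(tr_fun h3) e; rewrite -e in h2'.
  exact: tr_inj h2 h2'.
- move=> y w w' [x [z [h1 h2 h3]]] [x' [z' [h1' h2' h3']]].
  rewrite -(tr_fun h2 h2') in h3'; rewrite -(tr_inj h3 h3') in h1'.
  exact: tr_fun h1 h1'.
- move=> y w [x [z [h1 h2 h3]]].
  have [->|yw] := EM (y = w); first by left.
  right; split=> [y' [x' [z' [_ h2' _]]]|w' [x' [z' [h1' _ _]]]]; apply: yw.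
    by have e := tr_fun h3 (mul_tr h1 h2'); rewrite e in h2; apply: tr_inj h2' h2.
  by have e := tr_inj h3 (mul_tr h1' h2); rewrite e in h1; apply: tr_fun h1 h1'.
have K1 : cancel (fun x => g (h (f x))) (fun x => pback f (pback h (pback g x))).
  by move=> x; rewrite !pfunK.
have K2 : cancel (fun x => pback f (pback h (pback g x))) (fun x => g (h (f x))).
  by move=> x; rewrite !pbackK.
exists (Permutation K1 K2) => x z hxz /=.
have [y hy] := mul_dom hxz; have [w hw] := mul_cod hxz.
by rewrite -(fP _ _ hy) -(hP y w) ?(gP _ _ hw)//; exists x, z.
Qed.

Lemma extendable_idempotent a : brauer_mul a a = a -> extendable a.
Proof.
move=> aa; apply: swap_extension; [exact: tr_fun|exact: tr_inj|].
move=> x y hxy; have [->|xy] := EM (x = y); first by left.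
right; split=> z h; apply: xy.
  have h' : tr a z y by rewrite -aa; apply: mul_tr h hxy.
  by rewrite -(tr_fun h h').
have h' : tr a x z by rewrite -aa; apply: mul_tr hxy h.
by rewrite (tr_inj h h').
Qed.

Lemma extendable_perm (f : permutation X) : extendable (perm_elt f).
Proof. by exists f => x y /tr_perm. Qed.

Lemma star_extendable a : extendable a -> extendable (star a).
Proof.
by move=> [f fP]; exists (perm_inv f) => x y /tr_star/fP -> /=; rewrite pfunK.
Qed.

Lemma generated_closed (U : set (brauer X)) : mul_closed (generated U).
Proof.
by move=> a b ha hb S SP; apply: SP.1; [exact: (ha S SP)|exact: (hb S SP)].
Qed.

Lemma generated_sub (U V : set (brauer X)) :
  mul_closed V -> U `<=` V -> generated U `<=` V.
Proof. by move=> Vcl UV; apply: smallest_sub. Qed.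

Lemma FX_extendable a : FX X a -> extendable a.
Proof.
apply: generated_sub => [|b [/extendable_idempotent//|/unitP[f ->]]].
  exact: extendable_mul.
exact: extendable_perm.
Qed.

(** ** Elements with identity transversals *)

Record matching := Matching { mrel :> X -> X -> Prop;
  msym : forall x y, mrel x y -> mrel y x;
  mirr : forall x, ~ mrel x x;
  mfun : forall x y z, mrel x y -> mrel x z -> y = z }.
Implicit Types P Q U L : matching.

Lemma no_sym x y : (fun _ _ => False) x y -> (fun _ _ : X => False) y x.
Proof. by []. Qed.
Definition no_edges : matching := @Matching (fun _ _ => False) no_sym
  (fun _ => id) (fun _ _ _ h _ => False_ind _ h).

Lemma up_matching_fun a x y z : up a x y -> up a x z -> y = z.
Proof. by move=> h /(adj_deg h)[]. Qed.
Definition up_matching a : matching := Matching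
  (fun x y => @adj_sym _ a (inl x) (inl y)) (fun x => @adj_irr _ a (inl x))
  (@up_matching_fun a).

Lemma lo_matching_fun a x y z : lo a x y -> lo a x z -> y = z.
Proof. by move=> h /(adj_deg h)[]. Qed.
Definition lo_matching a : matching := Matching
  (fun x y => @adj_sym _ a (inr x) (inr y)) (fun x => @adj_irr _ a (inr x))
  (@lo_matching_fun a).

Section Union.
Variables (N : set X) (P U : matching).
(** Edges across the border of [N] are dropped, so that this is a matching for every [N]. *)
Definition union_rel x y := [/\ N x, N y & P x y] \/ [/\ ~ N x, ~ N y & U x y].
Lemma union_sym x y : union_rel x y -> union_rel y x.
Proof. by move=> [[? ? /msym ?]|[? ? /msym ?]]; [left|right]. Qed.
Lemma union_irr x : ~ union_rel x x.
Proof. by move=> [[_ _ /mirr]|[_ _ /mirr]]. Qed.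
Lemma union_fun x y z : union_rel x y -> union_rel x z -> y = z.
Proof.
by move=> [[? ? h]|[? ? h]] [[? ? h']|[? ? h']] //; apply: mfun h h'.
Qed.
Definition matching_union := Matching union_sym union_irr union_fun.
End Union.

Section Diag.
Variables (A : set X) (P Q : matching).
(** The normal form of an extendable element up to a unit. The matchings are cut down to [A], so [P]
    and [Q] may be arbitrary. *)
Definition diag_adj (u v : X + X) : Prop := match u, v with
  | inl x, inl y => [/\ A x, A y & P x y]
  | inr x, inr y => [/\ A x, A y & Q x y]
  | inl x, inr y | inr x, inl y => ~ A x /\ x = y
  end.
Lemma diag_sym u v : diag_adj u v -> diag_adj v u.
Proof.
by case: u v => [x|x] [y|y] //=; (try by move=> [? ? /msym ?]); move=> [? <-].
Qed.
Lemma diag_irr u : ~ diag_adj u u.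
Proof. by case: u => x [] // _ _ /mirr. Qed.
Lemma diag_deg u v w : diag_adj u v -> diag_adj u w -> v = w.
Proof.
case: u v w => [x|x] [y|y] [z|z] //=;
  try (by move=> [? ? h] [? ? h']; rewrite (mfun h h'));
  try (by move=> [? ? h] []); try (by move=> [? <-] []);
  by move=> [? <-] [? <-].
Qed.
Definition diag := Brauer diag_sym diag_irr diag_deg.
End Diag.

Lemma star_diag A P Q : star (diag A P Q) = diag A Q P.
Proof. by apply: brauer_ext => -[x|x] [y|y]. Qed.

Lemma diag_eq A P Q P' Q' :
  (forall x y, A x -> A y -> P x y <-> P' x y) ->
  (forall x y, A x -> A y -> Q x y <-> Q' x y) ->
  diag A P Q = diag A P' Q'.
Proof.
move=> h1 h2; apply: brauer_eq => x y; last 1 first.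
- by split=> -[Ax Ay h]; split=> //; apply/h2.
- by split=> -[Ax Ay h]; split=> //; apply/h1.
- by [].
Qed.

Lemma diag_set0 P Q : diag set0 P Q = brauer_one X.
Proof.
apply: brauer_eq => x y; split.
- by case.
- by move=> [z [[]|[]]].
- by move=> [_ <-]; exists x; left.
- by move=> [z [[[->] [->]]|[]//]]; split.
- by case.
- by move=> [z [[]|[]]].
Qed.

(* A component that starts at a vertex of [N] never leaves [N]. *)
Lemma diag_mul_sub N A P Q U L : N `<=` A ->
  (forall x y, A y -> U x y -> N x -> N y) ->
  brauer_mul (diag N P Q) (diag A U L) = diag A (matching_union N P U) L.
Proof.
move=> NA Ncl.
have trN x : ~ N x -> tr (diag N P Q) x x by [].
apply: mul_eq => [[x|x] [y|y]|[x|x] H].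
- move=> [Ax Ay [[Nx Ny h]|[Nx Ny h]]]; first exact: mul_up.
  by apply: (mul_up2 (trN _ Nx) _ (trN _ Ny)).
- move=> [nAx <-]; apply: mul_tr (trN x _) _; first by move/NA.
  by [].
- move=> [nAx <-]; apply: adj_sym; apply: mul_tr (trN x _) _; first by move/NA.
  by [].
- by move=> h; apply: mul_lo.
- have [Nx|nNx] := EM (N x).
    apply: mul_up_isolated => -[y|y] [] // _ Ny h.
    by apply: (H (inl y)); split; [apply: NA|apply: NA|left].
  apply: (mul_up_isolated2 (trN _ nNx)) => -[y|y]; last by move/(H (inr y)).
  move=> [Ax Ay h]; apply: (H (inl y)); split=> //; right; split=> // Ny.
  by apply: nNx; apply: Ncl (msym h) Ny.
- by apply: mul_lo_isolated => -[y|y]; [move/(H (inl y))|move/(H (inr y))].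
Qed.

(** Each factor is the identity on the support of the other, so both are copied into the product
    unchanged. *)
Lemma diag_mul_disj N A P Q U L : N `&` A = set0 ->
  brauer_mul (diag N P Q) (diag A U L) =
  diag (N `|` A) (matching_union N P U) (matching_union N Q L).
Proof.
rewrite -subset0 => NA.
have NA' x : N x -> ~ A x by move=> Nx Ax; apply: (NA x).
have trN x : ~ N x -> tr (diag N P Q) x x by [].
have trA x : ~ A x -> tr (diag A U L) x x by [].
have nNA x : (N `|` A) x -> ~ N x -> A x by case.
apply: mul_eq => [[x|x] [y|y]|[x|x] H].
- move=> [NAx NAy [[Nx Ny h]|[Nx Ny h]]]; first exact: mul_up.
  by apply: (mul_up2 (trN _ Nx) _ (trN _ Ny)); split=> //; apply: nNA.
- by move=> [nx <-]; apply: (mul_tr (trN x _) (trA x _)) => h; apply: nx;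
    [left|right].
- by move=> [nx <-]; apply: adj_sym; apply: (mul_tr (trN x _) (trA x _)) => h;
    apply: nx; [left|right].
- move=> [Nx' Ny' [[Nx Ny h]|[Nx Ny h]]]; last first.
    by apply: mul_lo; split=> //; apply: nNA.
  by apply: (mul_lo2 (trA x _) _ (trA y _)) => //; apply: NA'.
- have [Nx|nNx] := EM (N x).
    apply: mul_up_isolated => -[y|y] [] // _ Ny h.
    by apply: (H (inl y)); split; [left|left|left].
  apply: (mul_up_isolated2 (trN _ nNx)) => -[y|y].
    move=> [Ax Ay h]; apply: (H (inl y)); split; [right|right|right] => //.
    by split=> // /NA'.
  by move=> [nAx e]; apply: (H (inr y)); split=> // -[].
- have [Ax|nAx] := EM (A x).
    apply: mul_lo_isolated => -[y|y] [] // _ Ay h.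
    apply: (H (inr y)); split; [right|right|right] => //.
    by split=> // /NA'.
  apply: (mul_lo_isolated2 (trA _ nAx)) => -[y|y].
    by move=> [nNx e]; apply: (H (inl y)); split=> // -[].
  move=> [Nx Ny h]; apply: (H (inr y)); split; [left|left|left] => //.
Qed.

(** No transversal starts or ends in [A], so the upper row comes from the first factor and the lower
    row from the second. In particular every [diag A P Q] is idempotent, and rows can be recombined
    freely. *)
Lemma diag_mul A P Q U L :
  brauer_mul (diag A P Q) (diag A U L) = diag A P L.
Proof.
rewrite diag_mul_sub//; apply: diag_eq => // x y Ax Ay.
by split=> [[[]//|[]]|]//; left.
Qed.

Definition diagonal a := forall x y, tr a x y -> x = y.

Lemma diagonalE a : diagonal a ->
  a = diag (~` dom a) (up_matching a) (lo_matching a).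
Proof.
move=> da; apply: brauer_eq => x y.
- split=> [h|[]//]; split=> // -[z].
    exact: up_tr h.
  exact: (up_tr (adj_sym h)).
- split=> [h|[]]; first by split; [move=> n; apply: n; exists y|apply: da].
  by move=> /contrapT[z h] <-; rewrite {2}(da _ _ h).
- split=> [h|[]//]; split=> // -[z h'].
    by have e := da _ _ h'; rewrite -e in h'; apply: lo_tr h h'.
  by have e := da _ _ h'; rewrite -e in h'; apply: lo_tr (adj_sym h) h'.
Qed.

Lemma diag_diagonal A P Q : diagonal (diag A P Q).
Proof. by move=> x y []. Qed.

Lemma extendable_diag A P Q : extendable (diag A P Q).
Proof.
have h : cancel (@id X) id by [].
by exists (Permutation h h) => x y [].
Qed.

Lemma extendable_diagonal a : extendable a ->
  exists2 f : permutation X, diagonal (brauer_mul a (perm_elt f)) &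
    a = brauer_mul (brauer_mul a (perm_elt f)) (perm_elt (perm_inv f)).
Proof.
move=> [f fP]; exists (perm_inv f).
  by move=> x y /tr_permr/fP /(@pfun_inj _ f).
by rewrite mul_permrK.
Qed.

Lemma FXE : FX X = extendable.
Proof.
apply/seteqP; split=> [a|a /extendable_diagonal[f /diagonalE da ->]].
  exact: FX_extendable.
apply: generated_closed; apply: sub_gen_smallest; last first.
  by right; apply: perm_elt_unit.
by left; rewrite /brauer_idempotents /= da diag_mul.
Qed.

End Extendable.


(** * The invariants determine an element up to units *)

Definition bij_rel T U (A : set T) (B : set U) (R : T -> U -> Prop) :=
  [/\ forall a, A a -> exists2 b, B b & R a b,
      forall b, B b -> exists2 a, A a & R a b,
      forall a a' b, A a -> A a' -> B b -> R a b -> R a' b -> a = a' &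
      forall a b b', A a -> B b -> B b' -> R a b -> R a b' -> b = b'].

Lemma card_bij_rel T U (A : set T) (B : set U) : A #= B ->
  exists R, bij_rel A B R.
Proof.
move=> eAB; have [B0|/set0P[b0 _]] := eqVneq B set0.
  exists (fun _ _ => True); move: eAB; rewrite B0 card_eq0 => /eqP A0.
  by split; rewrite ?A0.
have [f [fA finj fsurj]] := card_eq_fun b0 eAB.
exists (fun a b => f a = b); split.
- by move=> a Aa; exists (f a) => //; apply: fA.
- by move=> b /fsurj.
- by move=> a a' b Aa Aa' _ <- /esym; apply: finj.
- by move=> a b b' _ _ _ <- <-.
Qed.

Lemma bij_rel_setU T U (A A' : set T) (B B' : set U) R R' :
  A `&` A' = set0 -> B `&` B' = set0 -> bij_rel A B R -> bij_rel A' B' R' ->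
  bij_rel (A `|` A') (B `|` B')
    (fun a b => [/\ A a, B b & R a b] \/ [/\ A' a, B' b & R' a b]).
Proof.
rewrite -!subset0 => AA BB [h1 h2 h3 h4] [h1' h2' h3' h4']; split.
- move=> a [Aa|Aa].
    by have [b Bb Rab] := h1 _ Aa; exists b; left.
  by have [b Bb Rab] := h1' _ Aa; exists b; right.
- move=> b [Bb|Bb].
    by have [a Aa Rab] := h2 _ Bb; exists a; left.
  by have [a Aa Rab] := h2' _ Bb; exists a; right.
- move=> a a' b _ _ _ [[Aa Bb r]|[Aa Bb r]] [[Aa' Bb' r']|[Aa' Bb' r']].
  + exact: h3 r r'.
  + by case: (BB b).
  + by case: (BB b).
  + exact: h3' r r'.
- move=> a b b' _ _ _ [[Aa Bb r]|[Aa Bb r]] [[Aa' Bb' r']|[Aa' Bb' r']].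
  + exact: h4 r r'.
  + by case: (AA a).
  + by case: (AA a).
  + exact: h4' r r'.
Qed.

Lemma bij_rel_permutation X (R : X -> X -> Prop) : bij_rel setT setT R ->
  exists f : permutation X, forall x, R x (f x).
Proof.
move=> [h1 h2 h3 h4].
have /choice[f fP] : forall x, exists y, R x y.
  by move=> x; have [//|y _ h] := h1 x; exists y.
have /choice[g gP] : forall y, exists x, R x y.
  by move=> y; have [//|x _ h] := h2 y; exists x.
have fK : cancel f g by move=> x; apply: (h3 _ _ (f x)).
have gK : cancel g f by move=> y; apply: (h4 (g y)).
by exists (Permutation fK gK).
Qed.

(** * Edges of a matching, and permutations carrying one matching to another *)

Section Edges.
Variable X : Type.
Implicit Types (P Q : matching X) (x y z : X).

Definition edges P : set (set X) :=
  [set e | exists x y, P x y /\ e = [set x; y]].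

Definition covered P : set X := [set x | exists y, P x y].

Lemma edge_eq P x y x' y' : P x y -> P x' y' -> [set x; y] = [set x'; y'] ->
  x = x' /\ y = y' \/ x = y' /\ y = x'.
Proof.
move=> h h' e; have : [set x'; y'] x by rewrite -e; left.
move=> [/= e'|/= e']; subst x.
  by left; split=> //; apply: mfun h h'.
by right; split=> //; apply: mfun h (msym h').
Qed.

(** Choice picks one end of every edge, and [o] marks the picked ends. This turns statements on
    edges into statements on vertices. *)
Lemma orientation P : exists o : X -> bool, forall x y, P x y -> o x = ~~ o y.
Proof.
have [[x0 _]|n] := pselect (exists x, covered P x); last first.
  by exists (fun => true) => x y h; case: n; exists x; exists y.
have /choice[r rP] : forall e : set X, exists x, e !=set0 -> e x.
  move=> e; have [[x ex]|n] := pselect (e !=set0); first by exists x.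
  by exists x0 => /n.
exists (fun x => `[< exists y, P x y /\ r [set x; y] = x >]) => x y h.
have rxy : r [set x; y] = x \/ r [set x; y] = y.
  by apply: (rP [set x; y]); exists x; left.
case: (asboolP (exists y, _)) => [[z [hz rz]]|nx].
  apply/esym/asboolPn => -[w [hw rw]].
  have ez := mfun h hz; have ew := mfun (msym h) hw; subst z w.
  by rewrite setUC rz in rw; subst y; case: (mirr h).
apply/esym/negbF/asboolP; exists x; split; first exact: msym.
rewrite setUC; case: rxy => // e; case: nx; by exists y.
Qed.

Section EdgeRel.
Variables (P Q : matching X) (E : set X -> set X -> Prop) (o o' : X -> bool).
Hypothesis Efun : forall e e1 e2,
  edges P e -> edges Q e1 -> edges Q e2 -> E e e1 -> E e e2 -> e1 = e2.
Hypothesis Etot : forall e, edges P e -> exists2 e', edges Q e' & E e e'.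
Hypothesis oP : forall x y, P x y -> o x = ~~ o y.
Hypothesis oQ : forall x y, Q x y -> o' x = ~~ o' y.

(** Lifts the correspondence [E] of edges to their ends: of the two ends of the image edge, the one
    with the same orientation value is taken. *)
Definition edge_rel x x' := exists y y',
  [/\ P x y, Q x' y', E [set x; y] [set x'; y'] & o x = o' x'].

Lemma edge_rel_tot x : covered P x -> exists2 x', covered Q x' & edge_rel x x'.
Proof.
move=> [y h]; have [|e [x' [y' [h' ->]]] hE] := Etot (e := [set x; y]).
  by exists x, y.
have [e'|] := eqVneq (o x) (o' x').
  by exists x'; [exists y'|exists y, y'].
rewrite (oQ h') => e'; exists y'; first by exists x'; apply: msym.
exists y, x'; split=> //; [exact: msym|by rewrite (setUC [set y'])|].
by case: (o x) (o' y') e' => -[].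
Qed.

Lemma edge_rel_edge x y x' y' : P x y -> edge_rel x x' -> edge_rel y y' ->
  Q x' y'.
Proof.
move=> h [z [z' [hz hz' Ez ez]]] [w [w' [hw hw' Ew ew]]].
rewrite -(mfun h hz) in Ez; rewrite -(mfun (msym h) hw) setUC in Ew.
have e : [set x'; z'] = [set y'; w'].
  apply: Efun Ez Ew; [by exists x, y|by exists x', z'|by exists y', w'].
have [[exy _]|[_ <-]] := edge_eq hz' hw' e; last by [].
by move: (oP h); rewrite ez ew exy; case: (o' y').
Qed.

Lemma edge_rel_fun x x' x'' : edge_rel x x' -> edge_rel x x'' -> x' = x''.
Proof.
move=> [z [z' [hz hz' Ez ez]]] [w [w' [hw hw' Ew ew]]].
rewrite -(mfun hz hw) in Ew.
have e : [set x'; z'] = [set x''; w'].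
  apply: Efun Ez Ew; [by exists x, z|by exists x', z'|by exists x'', w'].
have [[//]|[exw ezx]] := edge_eq hz' hw' e.
by move: (oQ hw'); rewrite -ew ez exw; case: (o' w').
Qed.
End EdgeRel.

Lemma edges_bij P Q : edges P #= edges Q ->
  exists2 R, bij_rel (covered P) (covered Q) R &
    forall x y x' y', R x x' -> R y y' -> P x y <-> Q x' y'.
Proof.
move=> /card_bij_rel[E [E1 E2 E3 E4]].
have [o oP] := orientation P; have [o' oQ] := orientation Q.
have E3' e e1 e2 : edges Q e -> edges P e1 -> edges P e2 ->
  E e1 e -> E e2 e -> e1 = e2 by move=> ? ? ?; apply: E3.
have sw x x' : edge_rel P Q E o o' x x' ->
    edge_rel Q P (fun e e' => E e' e) o' o x' x.
  by move=> [y [y' [h1 h2 h3 h4]]]; exists y', y.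
have sw' x x' : edge_rel Q P (fun e e' => E e' e) o' o x' x ->
    edge_rel P Q E o o' x x'.
  by move=> [y [y' [h1 h2 h3 h4]]]; exists y', y.
exists (edge_rel P Q E o o'); first split.
- by move=> a; apply: edge_rel_tot.
- move=> b hb.
  have [a ha /sw' h] := @edge_rel_tot Q P (fun e e' => E e' e) o' o E2 oP b hb.
  by exists a.
- move=> a a' b _ _ _ /sw h /sw h'; exact: (edge_rel_fun E3' oP h h').
- move=> a b b' _ _ _ h h'; exact: (edge_rel_fun E4 oQ h h').
move=> x y x' y' h h'; split=> hxy; first exact: (edge_rel_edge E4 oP hxy h h').
exact: (edge_rel_edge E3' oQ hxy (sw _ _ h) (sw _ _ h')).
Qed.

(** Bijections of the covered vertices, of the singletons and of the rest are glued together. The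
    one on [D] is prescribed by [R], since the permutations of the two rows must fit along the
    transversals. *)
Lemma matching_permutation P Q (S S' D D' : set X) (R : X -> X -> Prop) :
  (forall x, covered P x \/ S x \/ D x) ->
  (forall x, covered Q x \/ S' x \/ D' x) ->
  covered P `&` S = set0 -> covered Q `&` S' = set0 ->
  (covered P `|` S) `&` D = set0 -> (covered Q `|` S') `&` D' = set0 ->
  edges P #= edges Q -> S #= S' -> bij_rel D D' R ->
  exists f : permutation X,
    [/\ forall x y, P x y <-> Q (f x) (f y),
        forall x, D x -> D' (f x) /\ R x (f x) & forall x, D' (f x) -> D x].
Proof.
move=> cP cQ PS QS PD QD /edges_bij[R1 bR1 RPQ] /card_bij_rel[R2 bR2] bR.
have := bij_rel_setU PD QD (bij_rel_setU PS QS bR1 bR2) bR.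
have -> : covered P `|` S `|` D = setT.
  by rewrite -subTset => x _; have [|[]] := cP x; [left; left|left; right|right].
have -> : covered Q `|` S' `|` D' = setT.
  by rewrite -subTset => x _; have [|[]] := cQ x; [left; left|left; right|right].
move=> /bij_rel_permutation[f fP]; exists f.
move: PS QS PD QD; rewrite -!subset0 => PS QS PD QD; split.
- have key x : covered P x -> R1 x (f x).
    move=> h; have [[_ _ [[]//|[h' _ _]]]|[Dx _ _]] := fP x.
      by case: (PS x).
    by case: (PD x); split=> //; left.
  have key' x : covered Q (f x) -> R1 x (f x).
    move=> h; have [[_ _ [[]//|[_ h' _]]]|[_ Dx _]] := fP x.
      by case: (QS (f x)).
    by case: (QD (f x)); split=> //; left.
  move=> x y; split=> h.
    by apply/(RPQ x y) => //; apply: key; [exists y|exists x; apply: msym].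
  by apply/(RPQ x y (f x) (f y)) => //; apply: key';
    [exists (f y)|exists (f x); apply: msym].
- move=> x Dx; have [[h _ _]|[_ h1 h2]] := fP x; last by split.
  by case: (PD x).
- move=> x Dx; have [[_ h _]|[]//] := fP x.
  by case: (QD (f x)).
Qed.

End Edges.

(** * Cardinal invariants of a graph and of its reflection *)

Section Invariants.
Variable X : Type.
Implicit Types (a b c : brauer X) (x y z : X).

Lemma inl_set2 (x y : X) :
  @inl X X @` [set x; y] = [set inl x; inl y].
Proof.
apply/seteqP; split=> [_ [z [->|->] <-]|_ [->|->]]; [by left|by right| |].
  by exists x; [left|].
by exists y; [right|].
Qed.

Lemma image_inl_inj : injective (fun e : set X => @inl X X @` e).
Proof.
move=> e e' h; apply/seteqP; split=> x ex.
  have : (@inl X X @` e) (inl x) by exists x.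
  by rewrite h => -[y ey [<-]].
have : (@inl X X @` e') (inl x) by exists x.
by rewrite -h => -[y ey [<-]].
Qed.

Lemma card_upper_hooks a : upper_hooks a #= edges (up_matching a).
Proof.
have -> : upper_hooks a = (fun e : set X => @inl X X @` e) @` edges (up_matching a).
  apply/seteqP; split=> [_ [x [y [h ->]]]|_ [_ [x [y [h ->]]] <-]].
    by exists [set x; y]; [exists x, y|rewrite inl_set2].
  by exists x, y; rewrite inl_set2.
exact/card_image_inj/image_inl_inj.
Qed.

Lemma flip_set2 u v : @flip X @` [set u; v] = [set flip u; flip v].
Proof.
apply/seteqP; split=> [_ [z [->|->] <-]|_ [->|->]]; [by left|by right| |].
  by exists u; [left|].
by exists v; [right|].
Qed.

Lemma image_flip_inj : injective (fun e : set (X + X) => @flip X @` e).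
Proof.
move=> e e' h; apply/seteqP; split=> x ex.
  have : (@flip X @` e) (flip x) by exists x.
  by rewrite h => -[y ey /(can_inj (@flipK X)) <-].
have : (@flip X @` e') (flip x) by exists x.
by rewrite -h => -[y ey /(can_inj (@flipK X)) <-].
Qed.

Lemma lower_hooks_star a : lower_hooks a #= upper_hooks (star a).
Proof.
rewrite card_eq_sym.
have -> : upper_hooks (star a) =
    (fun e => @flip X @` e) @` lower_hooks a.
  apply/seteqP; split=> [_ [x [y [h ->]]]|_ [_ [x [y [h ->]]] <-]].
    by exists [set inr x; inr y]; [exists x, y|rewrite flip_set2].
  by exists x, y; rewrite flip_set2.
exact/card_image_inj/image_flip_inj.
Qed.

Lemma card_lower_hooks a : lower_hooks a #= edges (lo_matching a).
Proof. exact: card_eq_trans (lower_hooks_star a) (card_upper_hooks (star a)). Qed.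

Lemma upper_singletons_star a : upper_singletons (star a) = lower_singletons a.
Proof.
apply/seteqP; split=> x h v; first by have := h (flip v); rewrite /= flipK.
exact: h.
Qed.

Lemma dom_star a : dom (star a) = cod a.
Proof. by apply/seteqP; split=> x [y /tr_star h]; exists y. Qed.

Lemma card_dom_cod a : dom a #= cod a.
Proof.
apply: (card_eq_rel (R := tr a)).
- by move=> x [y h]; exists y => //; exists x.
- by move=> y [x h]; exists x => //; exists y.
- by move=> x x' y _ _ _; apply: tr_inj.
- by move=> x y y' _ _ _; apply: tr_fun.
Qed.

Lemma card_transversals a : transversals a #= dom a.
Proof.
apply: (card_eq_rel (R := fun e x => e (inl x))).
- by move=> _ [x [y [h ->]]]; exists x; [exists y|left].
- by move=> x [y h]; exists [set inl x; inr y]; [exists x, y|left].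
- move=> _ _ x [x1 [y1 [h1 ->]]] [x2 [y2 [h2 ->]]] _ [[e1]|//] [[e2]|//].
  by rewrite -e1 in h1 *; rewrite -e2 in h2 *; rewrite (tr_fun h1 h2).
- by move=> _ x x' [x1 [y1 [h1 ->]]] _ _ [[->]|//] [[->]|//].
Qed.

Lemma upper_cases a x : covered (up_matching a) x \/
  upper_singletons a x \/ dom a x.
Proof.
by have [h|h|h] := vertex_cases a x; [right; right|left|right; left].
Qed.

Lemma upper_disj1 a : covered (up_matching a) `&` upper_singletons a = set0.
Proof. by rewrite -subset0 => x [[y h] /(_ (inl y))]. Qed.

Lemma upper_disj2 a :
  (covered (up_matching a) `|` upper_singletons a) `&` dom a = set0.
Proof.
rewrite -subset0 => x [[[y h]|h] [z h']]; first exact: up_tr h h'.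
exact: h h'.
Qed.

Definition same_invariants a b :=
  [/\ transversals a #= transversals b,
      upper_hooks a #= upper_hooks b /\ lower_hooks a #= lower_hooks b &
      upper_singletons a #= upper_singletons b /\
      lower_singletons a #= lower_singletons b].

Lemma card_eq_conj T U T' U' (A : set T) (B : set U) (A' : set T') (B' : set U') :
  A #= A' -> B #= B' -> A #= B -> A' #= B'.
Proof. by move=> e1 e2 e; rewrite -(card_eql e1) -(card_eqr e2). Qed.

Lemma same_invariants_units a b : same_invariants b a ->
  exists f g : permutation X,
    b = brauer_mul (brauer_mul (perm_elt f) a) (perm_elt g).
Proof.
move=> [t [h h'] [s s']].
have /card_bij_rel[R bR] : dom b #= dom a.
  exact: card_eq_conj (card_transversals b) (card_transversals a) t.
have [f [fup fR fD]] := matching_permutation (upper_cases b) (upper_cases a)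
  (upper_disj1 b) (upper_disj1 a) (upper_disj2 b) (upper_disj2 a)
  (card_eq_conj (card_upper_hooks b) (card_upper_hooks a) h) s bR.
(* Through the transversals, the upper permutation [f] prescribes how the lower one acts on
   [cod b]. *)
pose R' y y' := exists2 x, tr b x y & tr a (f x) y'.
have fD' x : dom b x -> dom a (f x) by move/fR => [].
have bR' : bij_rel (cod b) (cod a) R'.
  split.
  - move=> y [x hxy]; have [y' hy'] : dom a (f x) by apply: fD'; exists y.
    by exists y'; [exists (f x)|exists x].
  - move=> y' [x']; rewrite -[x'](pbackK f) => h1.
    have [y hy] : dom b (pback f x') by apply: fD; exists y'.
    by exists y; [exists (pback f x')|exists (pback f x')].
  - move=> y z y' _ _ _ [x1 h1 h1'] [x2 h2 h2'].
    have e := pfun_inj (tr_inj h1' h2'); subst x2; exact: tr_fun h1 h2.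
  - move=> y y' z' _ _ _ [x1 h1 h1'] [x2 h2 h2'].
    have e := tr_inj h1 h2; rewrite e in h1'; exact: tr_fun h1' h2'.
have sb := upper_singletons_star b; have sa := upper_singletons_star a.
have db := dom_star b; have da := dom_star a.
have cb := upper_cases (star b); have ca := upper_cases (star a).
have b1 := upper_disj1 (star b); have a1 := upper_disj1 (star a).
have b2 := upper_disj2 (star b); have a2 := upper_disj2 (star a).
rewrite ?sb ?db in cb b1 b2; rewrite ?sa ?da in ca a1 a2.
have [g [gup gR gD]] := @matching_permutation _ (lo_matching b)
  (lo_matching a) _ _ _ _ R' cb ca b1 a1 b2 a2
  (card_eq_conj (card_lower_hooks b) (card_lower_hooks a) h') s' bR'.
exists f, (perm_inv g); apply: brauer_eq => x y.
- split=> [/fup hxy|/up_permr/up_perml/fup//].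
  by apply/up_permr/up_perml.
- split=> [hxy|/tr_permr/tr_perml /= hxy].
    apply/tr_permr/tr_perml => /=.
    have [_ [x' h1]] := gR y (ex_intro _ x hxy).
    by rewrite (tr_inj h1 hxy).
  have [z hz] : dom b x by apply: fD; exists (g y).
  have [_ [x' h1 h2]] := gR z (ex_intro _ x hz).
  rewrite (tr_inj h1 hz) in h2.
  by rewrite (pfun_inj (tr_fun hxy h2)).
- split=> [/gup hxy|/lo_permr/lo_perml/gup//].
  by apply/lo_permr/lo_perml.
Qed.

End Invariants.


(** * Generating sets *)

Section MatchingCards.
Variable X : Type.
Implicit Types (P Q : matching X) (a b d : brauer X) (A B N : set X).

(** An orientation separates the two ends of each edge; the ends of either kind are in bijection
    with the edges. *)
Lemma covered_halves P : exists A B : set X,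
  [/\ covered P = A `|` B, A `&` B = set0, A #= edges P & B #= edges P].
Proof.
have [o oP] := orientation P.
have half c : [set x | covered P x /\ o x = c] #= edges P.
  apply: (card_eq_rel (R := fun x e => exists2 y, P x y & e = [set x; y])).
  - by move=> x [[y h] _]; exists [set x; y]; [exists x, y|exists y].
  - move=> _ [x [y [h ->]]]; have [ox|ox] := eqVneq (o x) c.
      by exists x; [split=> //; exists y|exists y].
    exists y; last by exists x; [exact: msym|rewrite setUC].
    split; first by exists x; apply: msym.
    by move: ox; rewrite (oP _ _ h); case: (o y) c => -[].
  - move=> x x' _ [_ ox] [_ ox'] _ [y h ->] [y' h' e].
    have [[//]|[e1 e2]] := edge_eq h h' e; subst x y.
    by move: (oP _ _ h); rewrite ox ox'; case: c {ox ox'}.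
  - by move=> x e e' _ _ _ [y h ->] [y' h' ->]; rewrite (mfun h h').
exists [set x | covered P x /\ o x = true], [set x | covered P x /\ o x = false].
split=> //.
  apply/seteqP; split=> x; last by case=> -[].
  by move=> h; case e: (o x); [left|right].
by rewrite -subset0 => x [[_ h] [_]]; rewrite h.
Qed.

Lemma card_lt_eql T U V (A : set T) (B : set U) (C : set V) :
  A #= B -> A #< C -> B #< C.
Proof. by rewrite card_eq_sym => /card_eqW; apply: card_le_lt_trans. Qed.

Lemma card_lt_eqr T U V (A : set T) (B : set U) (C : set V) :
  B #= C -> A #< B -> A #< C.
Proof. by move=> /card_eqW le lt; apply: card_lt_le_trans lt le. Qed.

Lemma covered_small P T (C : set T) : additive_card C ->
  edges P #< C -> covered P #< C.
Proof.
have [A [B [-> _]]] := covered_halves P.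
rewrite card_eq_sym => eA; rewrite card_eq_sym => eB aC h.
by apply: card_lt_setU => //; [apply: card_lt_eql eA h|apply: card_lt_eql eB h].
Qed.

Lemma edges_le_covered P : edges P #<= covered P.
Proof.
have [A [B [-> _ eA _]]] := covered_halves P.
by rewrite -(card_le_eql eA); apply: subset_card_le => x; left.
Qed.

Lemma covered_infinite P : infinite_set (covered P) -> edges P #= covered P.
Proof.
move=> infP; have [A [B [eP _ eA eB]]] := covered_halves P.
apply: (@card_eq_trans _ _ _ _ B); first by rewrite card_eq_sym.
apply: (card_setU_infinite (B := A)) => //; rewrite (card_le_eql eA).
by apply: card_eqW; rewrite card_eq_sym.
Qed.

Lemma edges_infinite P : infinite_set (edges P) -> edges P #= covered P.
Proof.
move=> infP; apply: covered_infinite.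
exact: infinite_card_le infP (edges_le_covered P).
Qed.

Lemma domC_upper a : ~` dom a = covered (up_matching a) `|` upper_singletons a.
Proof.
apply/seteqP; split=> x; first by have [h|[h|//]] := upper_cases a x; [left|right].
by move=> h Dx; move: (upper_disj2 a); rewrite -subset0 => /(_ x); apply.
Qed.

Lemma card_domC_small a T (C : set T) : additive_card C ->
  upper_hooks a #< C -> upper_singletons a #< C -> ~` dom a #< C.
Proof.
move=> aC hh hs; rewrite domC_upper; apply: card_lt_setU => //.
apply: covered_small => //; exact: card_lt_eql (card_upper_hooks a) hh.
Qed.

Lemma card_domC_infinite a T (C : set T) : infinite_set C ->
  upper_hooks a #<= C -> upper_singletons a #<= C ->
  upper_hooks a #= C \/ upper_singletons a #= C -> ~` dom a #= C.
Proof.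
move=> infC hh hs hor; rewrite domC_upper card_eq_le; apply/andP; split.
  have [A [B [-> _ eA eB]]] := covered_halves (up_matching a).
  apply: card_le_setU => //; apply: card_le_setU => //.
    by rewrite (card_le_eql eA) -(card_le_eql (card_upper_hooks a)).
  by rewrite (card_le_eql eB) -(card_le_eql (card_upper_hooks a)).
case: hor => [e|e]; rewrite -(card_le_eql e); last exact: subset_card_le.
rewrite (card_le_eql (card_upper_hooks a)).
by apply: card_le_trans (edges_le_covered _) _; apply: subset_card_le.
Qed.

(** The extending permutation maps the complement of the domain onto the complement of the
    codomain. *)
Lemma extendable_card a : extendable a -> ~` dom a #= ~` cod a.
Proof.
move=> [f fP].
apply: (card_eq_rel (R := fun x y => y = f x)).
- move=> x nx; exists (f x) => // -[x' h]; apply: nx; exists (f x).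
  by have e := pfun_inj (fP _ _ h); subst x'.
- move=> y ny; exists (pback f y); last by rewrite /= pbackK.
  move=> -[y' h]; apply: ny; exists (pback f y).
  by have e := fP _ _ h; rewrite pbackK in e; subst y'.
- by move=> x x' y _ _ _ -> /(@pfun_inj _ f).
- by move=> x y y' _ _ _ -> ->.
Qed.

Lemma diagonal_cod a : diagonal a -> cod a = dom a.
Proof.
move=> da; apply/seteqP; split=> x [y h]; exists y;
  by have e := da _ _ h; subst y.
Qed.

Lemma star_diagonal a : diagonal a -> diagonal (star a).
Proof. by move=> da x y /tr_star/da. Qed.

Lemma upper_singletons_diag A P Q :
  upper_singletons (diag A P Q) = [set x | A x /\ forall y, A y -> ~ P x y].
Proof.
apply/seteqP; split=> x.
  move=> h; split; first by apply: contrapT => nAx; apply: (h (inr x)).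
  move=> y Ay hxy; apply: (h (inl y)); split=> //.
  by apply: contrapT => nAx; apply: (h (inr x)).
by move=> [Ax h] [y|y] []// _ Ay /h; apply.
Qed.

Lemma dom_diag A P Q : dom (diag A P Q) = ~` A.
Proof.
apply/seteqP; split=> x; first by move=> [y []].
by move=> nAx; exists x.
Qed.

Lemma covered_out P x y : P x y -> covered P x /\ covered P y.
Proof. by move=> h; split; [exists y|exists x; apply: msym]. Qed.

End MatchingCards.

(** ** Elements with a single kind of non-transversals on each side *)

Section Normal.
Variable X : Type.
Implicit Types (P Q : matching X) (a b d : brauer X) (A B C N : set X).

Definition normal C d :=
  [/\ diagonal d, ~` dom d #= C & dom d #= [set: X]].
(** This and the next condition concern the upper row only; for the lower row they are imposed on
    [star d]. *)
Definition all_hooks d := upper_singletons d = set0.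
Definition all_singletons d := forall x y, ~ up d x y.

Lemma star_normal C d : normal C d -> normal C (star d).
Proof.
move=> [dd e1 e2]; split; first exact: star_diagonal.
  by rewrite dom_star diagonal_cod.
by rewrite dom_star diagonal_cod.
Qed.

Lemma all_hooks_card C d : infinite_set C -> normal C d -> all_hooks d ->
  upper_hooks d #= C.
Proof.
move=> infC [_ e1 _] hd; apply: card_eq_trans (card_upper_hooks d) _.
have e : ~` dom d = covered (up_matching d).
  by rewrite domC_upper hd setU0.
rewrite e in e1; apply: card_eq_trans (e1); apply: covered_infinite.
by apply: card_eq_infinite infC; rewrite card_eq_sym.
Qed.

Lemma all_singletons_card C d : normal C d -> all_singletons d ->
  upper_singletons d #= C /\ upper_hooks d = set0.
Proof.
move=> [_ e1 _] hd; split; last first.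
  by rewrite -subset0 => e [x [y [h _]]]; apply: (hd x y).
move: e1; rewrite domC_upper.
have -> : covered (up_matching d) = set0 by rewrite -subset0 => x [y /hd].
by rewrite set0U.
Qed.

Definition same_type d d' := all_hooks d /\ all_hooks d' \/
  all_singletons d /\ all_singletons d'.

Lemma same_type_upper C d d' : infinite_set C -> normal C d -> normal C d' ->
  same_type d d' -> upper_hooks d #= upper_hooks d' /\
  upper_singletons d #= upper_singletons d'.
Proof.
move=> infC nd nd' [[h h']|[h h']].
  split; last by rewrite h h'.
  rewrite (card_eql (all_hooks_card infC nd h)) card_eq_sym.
  exact: all_hooks_card.
have [s ->] := all_singletons_card nd h; have [s' ->] := all_singletons_card nd' h'.
by split=> //; rewrite (card_eql s) card_eq_sym.
Qed.

Lemma same_type_invariants C d d' : infinite_set C -> normal C d ->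
  normal C d' -> same_type d d' -> same_type (star d) (star d') ->
  same_invariants d d'.
Proof.
move=> infC nd nd' st st'.
have [h s] := same_type_upper infC nd nd' st.
have [h' s'] := same_type_upper infC (star_normal nd) (star_normal nd') st'.
rewrite !upper_singletons_star in s'; split=> //.
  rewrite (card_eql (card_transversals d)) (card_eqr (card_transversals d')).
  by have [_ _ e] := nd; have [_ _ e'] := nd'; rewrite (card_eql e) card_eq_sym.
split=> //.
by rewrite (card_eql (lower_hooks_star d)) (card_eqr (lower_hooks_star d')).
Qed.

(** Together with the units, the elements [hook_elt P] and [sing_elt A] generate all extendable
    elements: [diag_decomp] writes every [diag A P Q] as a product of four of them. *)
Definition hook_elt P := diag (covered P) P P.
Definition sing_elt A := diag A (no_edges X) (no_edges X).

Lemma all_hooks_diag P Q : all_hooks (diag (covered P) P Q).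
Proof.
rewrite /all_hooks upper_singletons_diag -subset0 => x [[y h] /(_ y)].
by apply=> //; exists x; apply: msym.
Qed.

Lemma all_singletons_diag A Q : all_singletons (diag A (no_edges X) Q).
Proof. by move=> x y []. Qed.

Lemma normal_diag A P Q : ~` A #= [set: X] -> normal A (diag A P Q).
Proof.
by move=> h; split; rewrite ?dom_diag ?setCK//; apply: diag_diagonal.
Qed.

Lemma normal_eq C C' d : C #= C' -> normal C d -> normal C' d.
Proof. by move=> e [h1 h2 h3]; split=> //; apply: card_eq_trans e. Qed.

End Normal.


(** * Factorisations into hooks and singletons *)

Section Decompositions.
Variable X : Type.
Implicit Types (P Q : matching X) (a b d : brauer X) (A B C N : set X).

Definition restrict N P := matching_union N P (no_edges X).

Lemma restrictE N P x y : restrict N P x y <-> [/\ N x, N y & P x y].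
Proof. by split=> [[//|[_ _ []]]|]; left. Qed.

Lemma covered_restrict N P x : covered (restrict N P) x <->
  N x /\ exists2 y, N y & P x y.
Proof.
split=> [[y /restrictE[Nx Ny h]]|[Nx [y Ny h]]]; first by split=> //; exists y.
by exists y; apply/restrictE.
Qed.

(** No edge of [P] crosses the border of [N], so the two restrictions have disjoint supports and
    lose no edge. *)
Lemma hook_elt_split P N : (forall x y, P x y -> N x -> N y) ->
  hook_elt P =
  brauer_mul (hook_elt (restrict N P)) (hook_elt (restrict (~` N) P)).
Proof.
move=> Ncl.
have disj x : covered (restrict N P) x -> covered (restrict (~` N) P) x -> False.
  by move=> /covered_restrict[Nx _] /covered_restrict[].
have cov : covered P = covered (restrict N P) `|` covered (restrict (~` N) P).
  apply/seteqP; split=> x.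
    move=> [y h]; have [Nx|Nx] := EM (N x).
      by left; apply/covered_restrict; split=> //; exists y => //; apply: Ncl h Nx.
    right; apply/covered_restrict; split=> //; exists y => // Ny.
    exact/Nx/(Ncl _ _ (msym h)).
  by move=> [|] /covered_restrict[_ [y _ h]]; exists y.
rewrite /hook_elt diag_mul_disj -?cov; last first.
  by rewrite -subset0 => x [/disj].
have H x y : covered P x -> covered P y -> P x y <->
    matching_union (covered (restrict N P)) (restrict N P) (restrict (~` N) P) x y.
  move=> _ _; split=> [h|[[_ _ /restrictE[]//]|[_ _ /restrictE[]//]]].
  have [Nx|Nx] := EM (N x).
    have h' : restrict N P x y by apply/restrictE; split=> //; apply: Ncl h Nx.
    by left; have [? ?] := covered_out h'.
  right; split; try by move=> /covered_restrict[? ?]; apply: Nx => //; apply: Ncl (msym h) _.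
  by apply/restrictE; split=> // Ny; apply: Nx; apply: Ncl (msym h) Ny.
exact: diag_eq.
Qed.

Lemma edges_split P (E1 E2 : set (set X)) : edges P = E1 `|` E2 ->
  E1 `&` E2 = set0 -> exists N, [/\ forall x y, P x y -> N x -> N y,
    edges (restrict N P) = E1 & edges (restrict (~` N) P) = E2].
Proof.
move=> eP; rewrite -subset0 => disj.
have mem x y : P x y -> E1 [set x; y] \/ E2 [set x; y].
  move=> h; have : edges P [set x; y] by exists x, y.
  by rewrite eP.
have uniq x y e : P x y -> edges P e -> e x -> e = [set x; y].
  move=> h [z [w [h' ->]]] [/= ex|/= ex]; subst x; first by rewrite (mfun h h').
  by rewrite setUC (mfun h (msym h')).
have eE1 e : E1 e -> edges P e by rewrite eP; left.
have eE2 e : E2 e -> edges P e by rewrite eP; right.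
pose N := [set x | exists2 e, E1 e & e x].
have NE x y : P x y -> N x -> E1 [set x; y].
  by move=> h [e he ex]; rewrite -(uniq _ _ _ h (eE1 _ he) ex).
have Ncl x y : P x y -> N x -> N y.
  by move=> h /(NE _ _ h) h'; exists [set x; y] => //; right.
exists N; split=> //; apply/seteqP; split=> e.
- by move=> [x [y [/restrictE[Nx Ny h] ->]]]; apply: NE.
- move=> he; have [x [y [h eq]]] := eE1 _ he; exists x, y; split=> //.
  by apply/restrictE; split=> //; exists e; rewrite // eq; [left|right].
- move=> [x [y [/restrictE[Nx Ny h] ->]]]; have [h'|//] := mem _ _ h.
  by case: Nx; exists [set x; y] => //; left.
- move=> he; have [x [y [h eq]]] := eE2 _ he; exists x, y; split=> //.
  have nNx : ~ N x.
    by move=> /(NE _ _ h); rewrite -eq => h'; apply: (disj e).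
  by apply/restrictE; split=> // /(Ncl _ _ (msym h)).
Qed.

(** By [diag_mul], [diag A P Q] is the product of [diag A P P] and [diag A Q Q]; each of these
    splits into its hooks and its singletons, which have disjoint supports. *)
Lemma diag_decomp A P Q : exists P1 Q1 B1 B2,
  [/\ covered P1 `<=` A, covered Q1 `<=` A, B1 `<=` A, B2 `<=` A &
  diag A P Q = brauer_mul (brauer_mul (hook_elt P1) (sing_elt B1))
                          (brauer_mul (hook_elt Q1) (sing_elt B2))].
Proof.
have key R : exists R1 B, [/\ covered R1 `<=` A, B `<=` A &
    diag A R R = brauer_mul (hook_elt R1) (sing_elt B)].
  have sub : covered (restrict A R) `<=` A by move=> x /covered_restrict[].
  exists (restrict A R), (A `\` covered (restrict A R)); split=> //.
  rewrite /hook_elt /sing_elt diag_mul_disj; last first.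
    by rewrite -subset0 => x [h []].
  rewrite setDUK //.
  have H x y : A x -> A y -> R x y <-> matching_union
      (covered (restrict A R)) (restrict A R) (no_edges X) x y.
    move=> Ax Ay; split=> [h|[[_ _ /restrictE[]//]|[_ _ []]]].
    have h' : restrict A R x y by apply/restrictE.
    by left; have [] := covered_out h'.
  exact: diag_eq.
have [P1 [B1 [h1 h2 eP]]] := key P; have [Q1 [B2 [h3 h4 eQ]]] := key Q.
by exists P1, Q1, B1, B2; split; rewrite // -eP -eQ diag_mul.
Qed.

Lemma sing_elt_split A B : A `&` B = set0 ->
  sing_elt (A `|` B) = brauer_mul (sing_elt A) (sing_elt B).
Proof.
move=> disj; rewrite /sing_elt diag_mul_disj //.
by apply: diag_eq => x y _ _; split=> // -[[]|[]].
Qed.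

Lemma card_setC_infinite A : infinite_set [set: X] -> A #<= ~` A ->
  ~` A #= [set: X].
Proof. by move=> infX; apply: card_setU_infinite; rewrite // setUv. Qed.

Lemma finite_card_le_setC A : infinite_set [set: X] -> finite_set A ->
  A #<= ~` A.
Proof.
move=> infX finA; have infA : infinite_set (~` A).
  by move=> finC; apply: infX; rewrite -(setUv A) finite_setU.
by apply: card_le_trans (finite_set_countable finA) _; apply/infiniteP.
Qed.

(** ** Doubling and repairing *)

Lemma diagonal_perm a (f : permutation X) : diagonal a ->
  diagonal (brauer_mul (brauer_mul (perm_elt f) a) (perm_elt (perm_inv f))).
Proof. by move=> da x y /tr_permr/tr_perml/da /(@pfun_inj _ f). Qed.

(** One half of the complement of [A] receives a copy of [A], with which [A] is swapped; the other
    half stays free, so [|X|] points remain outside both copies. *)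
Lemma exists_displacement A : infinite_set [set: X] -> ~` A #= [set: X] ->
  exists f : permutation X,
    f @` A `&` A = set0 /\ ~` (A `|` f @` A) #= [set: X].
Proof.
move=> infX eA.
have infC : infinite_set (~` A) by apply: card_eq_infinite infX; rewrite card_eq_sym.
have [D1 [D2 [eD D12 e1 e2]]] := card_infinite_split infC.
have [x0 _] : [set: X] !=set0 by apply: infinite_setN0.
have leA : A #<= D1.
  rewrite (card_le_eqr e1) (card_le_eqr eA); exact: card_leT.
have [i [iD iinj]] := card_le_fun x0 leA.
have DA x : D1 x -> ~ A x by move=> h; have : (~` A) x by rewrite eD; left.
have [|||f fP] := @swap_extension _ (fun x y => A x /\ y = i x).
- by move=> x y z [_ ->] [_ ->].
- by move=> x y z [Ax ->] [Ay /iinj]; apply.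
- move=> x y [Ax ->]; right; split=> z [Az].
    by move=> ez; apply: (DA x) => //; rewrite ez; apply: iD.
  by move: Az => /(DA _ (iD _ Ax)).
have fA : f @` A `<=` D1.
  by move=> _ [x Ax <-]; rewrite -(fP x (i x)) //; apply: iD.
exists f; split; first by rewrite -subset0 => x [/fA/DA].
rewrite card_eq_le card_leT /=.
have e2X : D2 #= [set: X] by apply: card_eq_trans e2 eA.
rewrite -(card_le_eql e2X); apply: subset_card_le => x D2x [Ax|/fA D1x].
  by have : (~` A) x by rewrite eD; right.
by move: D12; rewrite -subset0 => /(_ x); apply.
Qed.

Section Pairing.
Variables (S : set X) (f : permutation X).
Hypothesis disj : forall x, S x -> ~ S (f x).
Definition pair_rel x y := S x /\ y = f x \/ S y /\ x = f y.
Lemma pair_sym x y : pair_rel x y -> pair_rel y x.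
Proof. by case; [right|left]. Qed.
Lemma pair_irr x : ~ pair_rel x x.
Proof. by move=> [] [Sx e]; apply: (disj Sx); rewrite -e. Qed.
Lemma pair_fun x y z : pair_rel x y -> pair_rel x z -> y = z.
Proof.
move=> [[Sx ->]|[Sy ex]] [[Sx' ->]|[Sz ez]] //.
- by case: (disj Sz); rewrite -ez.
- by case: (disj Sy); rewrite -ex.
- by apply: (@pfun_inj _ f); rewrite -ex.
Qed.
Definition pairing := Matching pair_sym pair_irr pair_fun.
Lemma covered_pairing : covered pairing = S `|` f @` S.
Proof.
apply/seteqP; split=> x; first by move=> [y [[Sx _]|[Sy ->]]]; [left|right; exists y].
by move=> [Sx|[y Sy <-]]; [exists (f x); left|exists y; right].
Qed.
End Pairing.

Lemma upper_singletons_perm a f g : upper_singletons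
  (brauer_mul (brauer_mul (perm_elt f) a) (perm_elt g)) =
  pfun (perm_inv f) @` upper_singletons a.
Proof.
set b := brauer_mul _ _; apply/seteqP; split=> x.
  move=> h; exists (f x); last exact: pfunK.
  move=> [y|y] hy.
    by apply: (h (inl (pback f y))); apply/up_permr/up_perml; rewrite pbackK.
  apply: (h (inr (g y))); apply/tr_permr/tr_perml; by rewrite pfunK.
move=> [y h <-] [z|z].
  by move=> /up_permr/up_perml; rewrite /= pbackK => /h.
by move=> /tr_permr/tr_perml; rewrite /= pbackK => /h.
Qed.

Lemma covered_perm a f g : covered (up_matching
  (brauer_mul (brauer_mul (perm_elt f) a) (perm_elt g))) =
  pfun (perm_inv f) @` covered (up_matching a).
Proof.
apply/seteqP; split=> x.
  move=> [y /up_permr/up_perml h]; exists (f x); last exact: pfunK.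
  by exists (f y).
move=> [y [z h] <-]; exists (pback f z); apply/up_permr/up_perml.
by rewrite /= !pbackK.
Qed.

Lemma dom_perm a f g : dom
  (brauer_mul (brauer_mul (perm_elt f) a) (perm_elt g)) =
  pfun (perm_inv f) @` dom a.
Proof.
apply/seteqP; split=> x.
  move=> [y /tr_permr/tr_perml h]; exists (f x); last exact: pfunK.
  by exists (pback g y).
move=> [y [z h] <-]; exists (g z); apply/tr_permr/tr_perml.
by rewrite /= pbackK pfunK.
Qed.

Lemma star_conj a f : star (brauer_mul (brauer_mul (perm_elt f) a)
    (perm_elt (perm_inv f))) =
  brauer_mul (brauer_mul (perm_elt f) (star a)) (perm_elt (perm_inv f)).
Proof.
rewrite !star_mul !star_perm.
have -> : perm_inv (perm_inv f) = f by case: f.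
apply: brauer_eq => x y; split.
- by move=> /up_perml/up_permr h; apply/up_permr/up_perml.
- by move=> /up_permr/up_perml h; apply/up_perml/up_permr.
- by move=> /tr_perml/tr_permr h; apply/tr_permr/tr_perml.
- by move=> /tr_permr/tr_perml h; apply/tr_perml/tr_permr.
- by move=> /lo_perml/lo_permr h; apply/lo_permr/lo_perml.
- by move=> /lo_permr/lo_perml h; apply/lo_perml/lo_permr.
Qed.

Lemma upper_singletonsE a :
  upper_singletons a = ~` dom a `\` covered (up_matching a).
Proof.
rewrite domC_upper; apply/seteqP; split=> x.
  by move=> h; split; [right|move=> [y /h]].
by move=> [[//|]].
Qed.

(* [b] is a copy of [a] displaced by [f]. Its singletons are paired off with
   those of [a], so no parity condition is needed for the matching [P]. *)
Lemma double_upper a b (f : permutation X) : diagonal a -> diagonal b ->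
  ~` dom b = f @` (~` dom a) -> f @` (~` dom a) `&` ~` dom a = set0 ->
  upper_singletons b = f @` upper_singletons a ->
  covered (up_matching b) = f @` covered (up_matching a) ->
  let d := brauer_mul a b in
  [/\ diagonal d, ~` dom d = ~` dom a `|` f @` (~` dom a),
      covered (up_matching d) =
        covered (up_matching a) `|` f @` covered (up_matching a) &
      exists P, covered P = upper_singletons d /\
        upper_singletons d = upper_singletons a `|` f @` upper_singletons a].
Proof.
move=> da db eD; rewrite -subset0 => disj eS eC d.
have ca : covered (up_matching a) `<=` ~` dom a.
  by rewrite domC_upper; left.
have sa : upper_singletons a `<=` ~` dom a by rewrite domC_upper; right.
have ed : d = diag (~` dom a `|` ~` dom b)
    (matching_union (~` dom a) (up_matching a) (up_matching b))
    (matching_union (~` dom a) (lo_matching a) (lo_matching b)).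
  rewrite /d {1}(diagonalE da) {1}(diagonalE db) diag_mul_disj //.
  by rewrite -subset0 => x [h1 h2]; apply: (disj x); rewrite -eD.
have eud : covered (up_matching d) =
    covered (up_matching a) `|` f @` covered (up_matching a).
  rewrite -eC; apply/seteqP; split=> x.
    rewrite ed => -[y [_ _ [[_ _ h]|[_ _ h]]]]; [left|right]; by exists y.
  rewrite ed => -[[y h]|[y h]]; exists y.
    have [cx cy] := covered_out (P := up_matching a) h.
    have dx := ca _ cx; have dy := ca _ cy.
    by split; [left|left|left].
  have [cx cy] := covered_out (P := up_matching b) h.
  have dx : (~` dom b) x by rewrite domC_upper; left.
  have dy : (~` dom b) y by rewrite domC_upper; left.
  split; [by right|by right|right; split=> // dz].
    by apply: (disj x); rewrite -eD.
  by apply: (disj y); rewrite -eD.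
have dd : diagonal d by rewrite ed; apply: diag_diagonal.
have edd : ~` dom d = ~` dom a `|` f @` (~` dom a).
  by rewrite {1}ed dom_diag setCK eD.
have esd : upper_singletons d = upper_singletons a `|` f @` upper_singletons a.
  rewrite upper_singletonsE edd eud -eS !upper_singletonsE eC -eD; apply/seteqP; split=> x.
    move=> [[dx|dx] n]; [left|right]; split=> // h; apply: n; [by left|by right].
  move=> [[dx n]|[dx n]]; split; [by left| |by right|].
    move=> [//|] [y /ca cy e]; apply: (disj x); split=> //.
    by exists y.
  by move=> [/ca h|//]; apply: (disj x); rewrite -eD.
have disjS x : upper_singletons a x -> ~ upper_singletons a (f x).
  move=> h h'; apply: (disj (f x)); split; first by exists x => //; apply: sa.
  exact: sa.
split=> //; exists (pairing disjS); split=> //.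
by rewrite covered_pairing esd.
Qed.

(** No upper edge of [d] meets its singletons, so the left factor adds the edges of [P] there and
    changes nothing else. *)
Lemma repair_singletons d P : diagonal d -> covered P = upper_singletons d ->
  exists2 P', all_hooks (diag (~` dom d) P' (lo_matching d)) &
    brauer_mul (diag (covered P) P P) d = diag (~` dom d) P' (lo_matching d).
Proof.
move=> dd eP.
have sub : covered P `<=` ~` dom d.
  by rewrite eP domC_upper; right.
exists (matching_union (covered P) P (up_matching d)); last first.
  rewrite {1}(diagonalE dd) diag_mul_sub // => x y _ h.
  by rewrite eP => /(_ (inl y)).
rewrite /all_hooks upper_singletons_diag -subset0 => x [dx n].
have [cx|cx] := EM (covered P x).
  have [y h] := cx; have [_ cy] := covered_out h.
  by apply: (n y); [apply: sub|left].
move: (dx); rewrite domC_upper => -[[y h]|]; last by rewrite -eP.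
have ncy : ~ covered P y by rewrite eP => /(_ (inl x)); apply; apply: msym h.
apply: (n y); last by right.
by rewrite domC_upper; left; exists x; apply: msym h.
Qed.

(** Isolating all covered vertices destroys the upper hooks and keeps the lower row. *)
Lemma repair_hooks d : diagonal d ->
  brauer_mul (sing_elt (covered (up_matching d))) d =
  diag (~` dom d) (no_edges X) (lo_matching d).
Proof.
move=> dd; rewrite {2}(diagonalE dd) diag_mul_sub.
- apply: diag_eq => x y dx dy //; split=> // -[[_ _ []]|[n _ h]].
  by case: n; exists y.
- by rewrite domC_upper; left.
- by move=> x y _ h _; exists x; apply: msym.
Qed.

End Decompositions.


(** * Commuting diagonal elements, and images under permutations *)

Section Commute.
Variable X : Type.
Implicit Types (P Q : matching X) (a b d : brauer X) (A B C N : set X).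

(** Reflection reverses a product; commuting the factors allows the argument for the upper row to be
    repeated for the reflected product. *)
Lemma diagonal_mulC a b : diagonal a -> diagonal b ->
  ~` dom a `&` ~` dom b = set0 -> brauer_mul a b = brauer_mul b a.
Proof.
move=> /diagonalE -> /diagonalE ->; rewrite !dom_diag !setCK => disj.
rewrite diag_mul_disj // diag_mul_disj 1?setIC // setUC.
move: disj; rewrite -subset0 => disj.
have key P Q x y : (~` dom b `|` ~` dom a) x -> (~` dom b `|` ~` dom a) y ->
    matching_union (~` dom a) P Q x y <-> matching_union (~` dom b) Q P x y.
  move=> xab yab; split=> -[[dx dy h]|[dx dy h]].
  - by right; split=> // ?; [apply: (disj x)|apply: (disj y)].
  - by left; split=> //; [case: xab|case: yab].
  - by right; split=> // ?; [apply: (disj x)|apply: (disj y)].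
  - by left; split=> //; [case: xab|case: yab].
by apply: diag_eq => x y *; apply: key.
Qed.

Lemma image_permC (f : permutation X) A : f @` (~` A) = ~` (f @` A).
Proof.
apply/seteqP; split=> [_ [x nA <-] [y Ay /(@pfun_inj _ f) e]|x n].
  by apply: nA; rewrite -e.
by exists (pback f x); [move=> Ax; apply: n; exists (pback f x); rewrite ?pbackK|rewrite pbackK].
Qed.

Definition perm_id : permutation X := @Permutation X id id (fun _ => erefl) (fun _ => erefl).

Lemma mul_perml_id a : brauer_mul (perm_elt perm_id) a = a.
Proof. by rewrite mul_perml; apply: brauer_ext => -[x|x] [y|y]. Qed.

Lemma mul_permr_id a : brauer_mul a (perm_elt perm_id) = a.
Proof.
apply: (can_inj (@starK X)); rewrite star_mul star_perm.
exact: mul_perml_id.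
Qed.

Lemma same_upper a b : (forall x y, up a x y <-> up b x y) -> dom a = dom b ->
  upper_singletons a = upper_singletons b /\
  covered (up_matching a) = covered (up_matching b).
Proof.
move=> h e; have ec : covered (up_matching a) = covered (up_matching b).
  by apply/seteqP; split=> x [y /h]; exists y.
by rewrite !upper_singletonsE e ec.
Qed.

Lemma card_perm_image (f : permutation X) A : f @` A #= A.
Proof. exact/card_image_inj/pfun_inj. Qed.

End Commute.

(** * Normalising elements of infinite defect *)

Section Generation.
Variable X : Type.
Hypothesis infX : infinite_set [set: X].
Implicit Types (P Q : matching X) (a b d : brauer X) (A B C N : set X).

Section Normalise.
Variable C : set X.
Hypothesis infC : infinite_set C.

(** The form in which the induction on cardinals is used: [M] contains all diagonal elements with
    support smaller than [C]. *)
Definition small_in (M : set (brauer X)) :=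
  forall A P Q, A #< C -> M (diag A P Q).

Lemma small_star M : small_in M -> small_in [set a | M (star a)].
Proof. by move=> h A P Q lt; rewrite /= star_diag; apply: h. Qed.

Lemma closed_star (M : set (brauer X)) :
  mul_closed M -> mul_closed [set a | M (star a)].
Proof. by move=> h a b ha hb; rewrite /= star_mul; apply: h. Qed.

(** This and [singles_type] are the conditions on the upper rows of [alpha_mu] and [beta_mu] for
    [mu = |C|]; for the lower rows they are imposed on [star a]. *)
Definition hooks_type a := upper_singletons a #< C /\ upper_hooks a #= C.
Definition singles_type a := upper_hooks a #< C /\ upper_singletons a #= C.

Lemma type_domC a : hooks_type a \/ singles_type a -> ~` dom a #= C.
Proof.
move=> [[h1 h2]|[h1 h2]]; apply: card_domC_infinite => //;
  do [exact: card_lt_le h1|exact: card_eqW h2|by left|by right].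
Qed.

(** What is needed of the doubled element [d] in order to repair it; the type of the original [a]
    decides which implication applies. The matching on all singletons of [d] is what doubling
    provides. *)
Definition repairable a d :=
  (upper_singletons a #< C -> upper_singletons d #< C /\
    exists P, covered P = upper_singletons d) /\
  (upper_hooks a #< C -> covered (up_matching d) #< C).

(** The corrections are left factors whose supports are smaller than [C], hence in [M]; they change
    the upper row only. *)
Lemma repair (M : set (brauer X)) a d : mul_closed M -> small_in M ->
  diagonal d -> M d -> repairable a d -> hooks_type a \/ singles_type a ->
  exists P', M (diag (~` dom d) P' (lo_matching d)) /\
   (hooks_type a /\ all_hooks (diag (~` dom d) P' (lo_matching d)) \/
    singles_type a /\ all_singletons (diag (~` dom d) P' (lo_matching d))).
Proof.
move=> Mmul Msm dd Md [r1 r2] [ta|ta].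
  have [sm [P eP]] := r1 ta.1.
  have [P' h1 h2] := repair_singletons dd eP.
  exists P'; split; last by left.
  by rewrite -h2; apply: Mmul => //; apply: Msm; rewrite eP.
exists (no_edges X); split; last first.
  by right; split=> //; apply: all_singletons_diag.
by rewrite -repair_hooks //; apply: Mmul => //; apply: Msm; apply: r2 ta.1.
Qed.

Variable M : set (brauer X).
Hypotheses (Mmul : mul_closed M) (Munit : brauer_units X `<=` M).
Hypothesis Msmall : small_in M.

(** Stated for the upper row of a diagonal [a0], so that it applies both to the element and to its
    reflection. *)
Lemma double_repairable a a0 b (f : permutation X) : diagonal a0 ->
  b = brauer_mul (brauer_mul (perm_elt (perm_inv f)) a0)
        (perm_elt (perm_inv (perm_inv f))) ->
  f @` (~` dom a0) `&` ~` dom a0 = set0 ->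
  (upper_singletons a #< C -> upper_singletons a0 #< C) ->
  (upper_hooks a #< C -> covered (up_matching a0) #< C) ->
  [/\ diagonal (brauer_mul a0 b),
      ~` dom (brauer_mul a0 b) = ~` dom a0 `|` f @` (~` dom a0) &
      repairable a (brauer_mul a0 b)].
Proof.
move=> da eb disj u0 c0.
have db : diagonal b by rewrite eb; apply: diagonal_perm.
have [|||h1 h2 h3 [P [h4 h5]]] := @double_upper _ a0 b f da db _ disj.
- by rewrite eb dom_perm image_permC.
- by rewrite eb upper_singletons_perm.
- by rewrite eb covered_perm.
have aC : additive_card C by left.
split=> //; split=> h.
  split; last by exists P.
  have sm := u0 h.
  by rewrite h5; apply: card_lt_setU => //; apply: card_lt_image.
have sm := c0 h.
by rewrite h3; apply: card_lt_setU => //; apply: card_lt_image.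
Qed.

(** A unit makes [a] diagonal, a displaced copy doubles it, and then the minority kind of vertices
    is removed from the upper row and, by reflection, from the lower row. *)
Lemma normalise a : M a -> extendable a -> transversals a #= [set: X] ->
  hooks_type a \/ singles_type a ->
  hooks_type (star a) \/ singles_type (star a) ->
  exists d, [/\ M d, normal C d,
    hooks_type a /\ all_hooks d \/ singles_type a /\ all_singletons d &
    hooks_type (star a) /\ all_hooks (star d) \/
    singles_type (star a) /\ all_singletons (star d)].
Proof.
have aC : additive_card C by left.
move=> Ma ea ta ua la.
have [g dag _] := extendable_diagonal ea.
set a0 := brauer_mul a (perm_elt g) in dag.
have e0 : a0 = brauer_mul (brauer_mul (perm_elt (perm_id X)) a) (perm_elt g).
  by rewrite mul_perml_id.
have e0' : star a0 = brauer_mul (brauer_mul (perm_elt (perm_inv g)) (star a))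
    (perm_elt (perm_id X)).
  by rewrite mul_permr_id star_mul star_perm.
have Ma0 : M a0 by apply: Mmul => //; apply/Munit/perm_elt_unit.
have sing0 (c c0 : brauer X) f h : c0 = brauer_mul (brauer_mul (perm_elt f) c) (perm_elt h) ->
    upper_singletons c #< C -> upper_singletons c0 #< C.
  by move=> ->; rewrite upper_singletons_perm; apply: card_lt_image.
have cov0 (c c0 : brauer X) f h : c0 = brauer_mul (brauer_mul (perm_elt f) c) (perm_elt h) ->
    upper_hooks c #< C -> covered (up_matching c0) #< C.
  move=> -> lt; rewrite covered_perm; apply: card_lt_image.
  by apply: covered_small => //; apply: card_lt_eql (card_upper_hooks _) lt.
have ed0 : dom a0 = dom a.
  rewrite e0 dom_perm; apply/seteqP.
  by split=> [x [y h <-]//|x h]; exists x.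
have dC : ~` dom a0 #= C by rewrite ed0; apply: type_domC.
have dX : ~` ~` dom a0 #= [set: X].
  rewrite setCK ed0; apply: card_eq_trans ta.
  by rewrite card_eq_sym; apply: card_transversals.
have [f [disj fX]] := exists_displacement infX dX.
(* Left multiplication by a unit pulls vertices back, so the unit of [perm_inv f] moves the support
   forward by [f]. *)
pose b := brauer_mul (brauer_mul (perm_elt (perm_inv f)) a0)
  (perm_elt (perm_inv (perm_inv f))).
pose d := brauer_mul a0 b.
have Mp h : M (perm_elt h) by apply/Munit/perm_elt_unit.
have Md : M d by apply: (Mmul Ma0); apply: Mmul => //; apply: Mmul.
have [dd eD rd] := double_repairable dag (erefl b) disj (sing0 _ _ _ _ e0)
  (cov0 _ _ _ _ e0).
have esb : star b = brauer_mul (brauer_mul (perm_elt (perm_inv f)) (star a0))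
  (perm_elt (perm_inv (perm_inv f))) by rewrite -star_conj.
have db : diagonal b by apply: diagonal_perm.
have edb : ~` dom b = f @` (~` dom a0) by rewrite dom_perm image_permC.
(* The supports are disjoint, so the reversal of the product can be undone. *)
have esd : star d = brauer_mul (star a0) (star b).
  rewrite star_mul diagonal_mulC //; try exact: star_diagonal.
  by rewrite !dom_star !diagonal_cod // edb.
have dsd : f @` (~` dom (star a0)) `&` ~` dom (star a0) = set0.
  by rewrite dom_star diagonal_cod.
have [_ _ rsd] := double_repairable (star_diagonal dag) esb dsd
  (sing0 _ _ _ _ e0') (cov0 _ _ _ _ e0').
rewrite -esd in rsd; rewrite -/d in dd eD rd.
have [P1 [Md1 t1]] := repair Mmul Msmall dd Md rd ua.
set d1 := diag _ _ _ in Md1 t1.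
have dd1 : diagonal (star d1) by apply: star_diagonal; apply: diag_diagonal.
have dsd1 : dom (star d1) = dom (star d).
  by rewrite star_diag dom_diag setCK dom_star diagonal_cod.
(* The first repair kept the lower row, so [star d1] inherits from [star d] what the second repair
   needs. *)
have usd1 x y : up (star d1) x y <-> up (star d) x y.
  rewrite star_diag; split=> [[]//|h].
  have e : ~` dom d = covered (up_matching (star d)) `|` upper_singletons (star d).
    by rewrite -domC_upper dom_star diagonal_cod.
  by split=> //; rewrite e; left; [exists y|exists x; apply: adj_sym].
have [es ec] := same_upper usd1 dsd1.
have rsd1 : repairable (star a) (star d1) by rewrite /repairable es ec.
(* The lower row is repaired as an upper row, inside the reflection of [M]. *)
have Msd1 : [set c | M (star c)] (star d1) by rewrite /= starK.
have [P2 [Md2 t2]] := repair (closed_star Mmul) (small_star Msmall) dd1 Msd1 rsd1 la.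
set d2 := diag _ _ _ in Md2 t2.
have edd : dom (star d2) = dom d.
  by rewrite star_diag dom_diag setCK dsd1 dom_star diagonal_cod.
exists (star d2); split=> //.
- split; first by apply: star_diagonal; apply: diag_diagonal.
    rewrite edd eD card_eq_le; apply/andP; split.
      apply: card_le_setU; [done|exact: card_eqW|].
      by rewrite (card_le_eql (card_perm_image f _)); apply: card_eqW.
    by rewrite -(card_le_eql dC); apply: subset_card_le; left.
  by rewrite edd -[dom d]setCK eD.
- have ud2 x y : up (star d2) x y <-> up d1 x y.
    rewrite star_diag; split=> [[]//|h]; split=> //.
      by rewrite dsd1 dom_star diagonal_cod //; case: h.
    by rewrite dsd1 dom_star diagonal_cod //; case: h.
  have edd1 : dom (star d2) = dom d1 by rewrite edd dom_diag setCK.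
  have [es1 _] := same_upper ud2 edd1.
  by case: t1 => -[ta1 h]; [left|right]; split=> //; [rewrite /all_hooks es1|move=> x y /ud2/h].
- by rewrite starK.
Qed.

End Normalise.
End Generation.


(** * Sufficiency: generating pairs generate all extendable elements *)

Section Sufficiency.
Variable X : Type.
Hypothesis infX : infinite_set [set: X].
Implicit Types (P Q : matching X) (a b d : brauer X) (A B C N : set X).

Lemma card_set1_unit T (x : T) : [set x] #= [set: unit].
Proof.
have -> : [set: unit] = [set tt] by apply/seteqP; split=> // -[].
exact: cardinality.eq_card1.
Qed.

Lemma has_cardE T (E : set T) A : has_card E (cardinal_of A) <-> E #= A.
Proof.
split=> [[B eB e]|e]; first exact: card_eq_trans eB.
by exists A => //; apply: card_eqxx.
Qed.

Lemma has_card_ltE T (E : set T) A : has_card_lt E (cardinal_of A) <-> E #< A.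
Proof.
split=> [[B eB e]|e]; first exact: card_lt_eqr eB e.
by exists A => //; apply: card_eqxx.
Qed.

Lemma hooks_type_star C a :
  hooks_type C (star a) <-> lower_singletons a #< C /\ lower_hooks a #= C.
Proof.
by rewrite /hooks_type upper_singletons_star (card_eql (lower_hooks_star a)).
Qed.

Lemma singles_type_star C a :
  singles_type C (star a) <-> lower_hooks a #< C /\ lower_singletons a #= C.
Proof.
rewrite /singles_type upper_singletons_star; split=> -[h1 h2]; split=> //.
  by apply: card_lt_eql h1; rewrite card_eq_sym lower_hooks_star.
by apply: card_lt_eql h1; rewrite lower_hooks_star.
Qed.

Lemma generating_pairE C a b : generating_pair (cardinal_of C) a b <->
  [/\ transversals a #= [set: X] /\ transversals b #= [set: X],
      hooks_type C a, singles_type C b &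
      hooks_type C (star a) /\ singles_type C (star b) \/
      singles_type C (star a) /\ hooks_type C (star b)].
Proof.
split.
  move=> [ht [/has_card_ltE h1 /has_cardE h2] [/has_card_ltE h3 /has_cardE h4] h].
  split=> //; case: h => -[].
    move=> /has_card_ltE ? /has_cardE ? /has_card_ltE ? /has_cardE ?.
    by left; rewrite hooks_type_star singles_type_star.
  move=> /has_card_ltE ? /has_cardE ? /has_card_ltE ? /has_cardE ?.
  by right; rewrite hooks_type_star singles_type_star.
move=> [ht [h1 h2] [h3 h4] h]; split=> //.
- by split; [apply/has_card_ltE|apply/has_cardE].
- by split; [apply/has_card_ltE|apply/has_cardE].
case: h => -[].
  move=> /hooks_type_star[? ?] /singles_type_star[? ?]; left.
  by split; [apply/has_card_ltE|apply/has_cardE|apply/has_card_ltE|apply/has_cardE].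
move=> /singles_type_star[? ?] /hooks_type_star[? ?]; right.
by split; [apply/has_card_ltE|apply/has_cardE|apply/has_card_ltE|apply/has_cardE].
Qed.

Lemma type_exclusive C a : hooks_type C a -> singles_type C a -> False.
Proof. by move=> [_ h] [[_]]. Qed.

(** A single hook leaves two vertices outside the domain, a single singleton leaves one. Since an
    extendable element has equal defects above and below, only the first alternative for the lower
    rows can occur when [mu = 1]. *)
Lemma unit_hooks_singles C a b : C #= [set: unit] ->
  hooks_type C a -> singles_type C b -> ~ (~` dom a #= ~` dom b).
Proof.
move=> C1 [_ ha] [hb sb] e.
have hb0 := card_lt_unit C1 hb.
have eb : ~` dom b = upper_singletons b.
  rewrite domC_upper; suff -> : covered (up_matching b) = set0 by rewrite set0U.
  rewrite -subset0 => x [y h].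
  suff : upper_hooks b [set inl x; inl y] by rewrite hb0.
  by exists x, y.
have [A [B [eAB AB eA eB]]] := covered_halves (up_matching a).
have eC : edges (up_matching a) #= C.
  by rewrite -(card_eql (card_upper_hooks a)).
have ne (D : set X) : D #= edges (up_matching a) -> D !=set0.
  move=> eD; apply/set0P/negP => /eqP D0; have : @set0 X #= [set: unit].
    by rewrite -D0 (card_eql eD) (card_eql eC).
  by rewrite card_eq_sym card_eq0 => /eqP/seteqP[/(_ tt I)].
have [x Ax] := ne _ eA; have [y By] := ne _ eB.
have e1 : ~` dom a #= [set: unit].
  by rewrite (card_eql e) eb (card_eql sb).
have [f [_ finj _]] := card_eq_fun tt e1.
have dA : (~` dom a) x by rewrite domC_upper eAB; left; left.
have dB : (~` dom a) y by rewrite domC_upper eAB; left; right.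
have exy : x = y by apply: finj => //; case: (f x); case: (f y).
by move: AB; rewrite -subset0 => /(_ x); apply; split; rewrite // exy.
Qed.

Lemma card_edges_diag P Q : upper_hooks (diag (covered P) P Q) #= edges P.
Proof.
apply: card_eq_trans (card_upper_hooks _) _.
suff -> : edges (up_matching (diag (covered P) P Q)) = edges P by apply: card_eqxx.
apply/seteqP; split=> _ [x [y [h ->]]]; exists x, y; split=> //.
  by case: h.
by have [h1 h2] := covered_out h.
Qed.

Lemma finite_covered P : finite_set (edges P) -> finite_set (covered P).
Proof.
have [A [B [-> _ eA eB]]] := covered_halves P.
move=> fin; rewrite finite_setU; split.
  by apply: card_le_finite (card_eqW eA) fin.
by apply: card_le_finite (card_eqW eB) fin.
Qed.

Variable M : set (brauer X).
Hypotheses (Mmul : mul_closed M) (Munit : brauer_units X `<=` M).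
Hypothesis Mgen : forall A : set X, additive_card A -> exists a b,
  [/\ M a, M b, extendable a, extendable b &
      generating_pair (cardinal_of A) a b].

Lemma closed_invariants a b : M a -> same_invariants b a -> M b.
Proof.
move=> Ma /same_invariants_units[f [g ->]].
by apply: Mmul; first apply: Mmul => //; apply/Munit/perm_elt_unit.
Qed.

Lemma closed_set0 P Q : M (diag set0 P Q).
Proof.
rewrite diag_set0; apply: Munit; apply/unitP; exists (perm_id X).
by apply: brauer_ext => -[x|x] [y|y].
Qed.

Lemma hooks_both C a : C #= [set: unit] -> extendable a -> hooks_type C a ->
  hooks_type C (star a) \/ singles_type C (star a) -> hooks_type C (star a).
Proof.
move=> C1 ea h [//|h']; case: (unit_hooks_singles C1 h h').
by rewrite dom_star; apply: extendable_card.
Qed.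

Lemma singles_both C a : C #= [set: unit] -> extendable a -> singles_type C a ->
  hooks_type C (star a) \/ singles_type C (star a) -> singles_type C (star a).
Proof.
move=> C1 ea h [h'|//]; case: (unit_hooks_singles C1 h' h).
by rewrite dom_star card_eq_sym; apply: extendable_card.
Qed.

Lemma singletons_sing A : upper_singletons (sing_elt A) = A.
Proof.
by rewrite upper_singletons_diag; apply/seteqP; split=> [x []//|x Ax]; split=> // y _ [].
Qed.

Lemma hooks_sing A : upper_hooks (sing_elt A) = set0.
Proof. by rewrite -subset0 => e [x [y [[]]]]. Qed.

Lemma diag_transversals A P Q a : A #<= ~` A ->
  transversals a #= [set: X] -> transversals (diag A P Q) #= transversals a.
Proof.
move=> le ta; rewrite (card_eql (card_transversals _)) dom_diag (card_eqr ta).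
exact: card_setC_infinite.
Qed.

Lemma unit_card_finite T (A : set T) : A #= [set: unit] -> finite_set A.
Proof.
by move=> /eq_finite_set ->; exact: finite_finset.
Qed.

(** By [singles_both], the generator of singleton type for the cardinal one has one singleton and no
    hook on either row, hence the invariants of [sing_elt A]. *)
Lemma sing_elt_unit A : A #= [set: unit] -> M (sing_elt A).
Proof.
move=> A1; have [a [b [_ Mb _ eb]]] := Mgen (or_intror A1).
move=> /generating_pairE[[_ tb] _ sb h].
have sb' : singles_type A (star b).
  by apply: (singles_both A1 eb sb); case: h => -[_]; [right|left].
apply: (closed_invariants Mb).
have [h1 s1] := sb; have [h2 s2] := sb'.
have := card_lt_unit A1 h1; have := card_lt_unit A1 h2 => eh2 eh1.
split.
- apply: diag_transversals => //; apply: finite_card_le_setC => //.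
  exact: unit_card_finite.
- rewrite hooks_sing eh1; split; first exact: card_eq00.
  rewrite (card_eql (lower_hooks_star _)) (card_eqr (lower_hooks_star _)).
  by rewrite eh2 /sing_elt star_diag hooks_sing; apply: card_eq00.
- rewrite singletons_sing card_eq_sym; split=> //.
  rewrite -!upper_singletons_star /sing_elt star_diag singletons_sing.
  by rewrite card_eq_sym.
Qed.

Lemma hook_elt_unit P : edges P #= [set: unit] -> M (hook_elt P).
Proof.
move=> P1; have [A [B [_ _ eA _]]] := covered_halves P.
have A1 : A #= [set: unit] by rewrite (card_eql eA).
have [a [b [Ma _ ea _]]] := Mgen (or_intror A1).
move=> /generating_pairE[[ta _] ha _ h].
have ha' : hooks_type A (star a).
  by apply: (hooks_both A1 ea ha); case: h => -[h _]; [left|right].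
apply: (closed_invariants Ma).
have [s1 h1] := ha; have [s2 h2] := ha'.
have := card_lt_unit A1 s1; have := card_lt_unit A1 s2 => es2 es1.
split.
- apply: diag_transversals => //; apply: finite_card_le_setC => //.
  by apply: finite_covered; apply: unit_card_finite.
- rewrite (card_eql (card_edges_diag _ _)) (card_eqr h1) card_eq_sym; split=> //.
  rewrite (card_eql (lower_hooks_star _)) (card_eqr (lower_hooks_star _)).
  by rewrite star_diag (card_eql (card_edges_diag _ _)) (card_eqr h2) card_eq_sym.
- rewrite -!upper_singletons_star es1 es2 star_diag.
  by rewrite !all_hooks_diag; split; apply: card_eq00.
Qed.

Lemma sing_elt_finite n A : A #= `I_n -> M (sing_elt A).
Proof.
elim: n A => [|n IH] A.
  by rewrite II0 card_eq0 => /eqP ->; apply: closed_set0.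
move=> /eq_cardSP[x Ax e].
rewrite -(@setDUK _ [set x] A); last by move=> _ ->.
rewrite sing_elt_split; last by rewrite setDIK.
by apply: Mmul; [apply/sing_elt_unit/card_set1_unit|apply: IH].
Qed.

Lemma hook_elt_finite n P : edges P #= `I_n -> M (hook_elt P).
Proof.
elim: n P => [|n IH] P.
  rewrite II0 card_eq0 => /eqP P0; rewrite /hook_elt.
  have -> : covered P = set0; last exact: closed_set0.
  rewrite -subset0 => x [y h].
  have : edges P [set x; y] by exists x, y.
  by rewrite P0.
move=> /eq_cardSP[e Pe eP].
have eU : edges P = [set e] `|` edges P `\` [set e].
  by rewrite setDUK // => _ ->.
have dis : [set e] `&` (edges P `\` [set e]) = set0 by rewrite setDIK.
have [N [Ncl e1 e2]] := edges_split eU dis.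
rewrite (hook_elt_split Ncl); apply: Mmul; last by apply: IH; rewrite e2.
by apply: hook_elt_unit; rewrite e1; apply: card_set1_unit.
Qed.

Section InfiniteStep.
Variable C : set X.
Hypothesis infC : infinite_set C.
Hypothesis IH : forall B, B #< C ->
  M (sing_elt B) /\ forall P, edges P #= B -> M (hook_elt P).

(** The factors given by [diag_decomp] have their supports inside [A], so the induction hypothesis
    covers them. *)
Lemma small_elements : small_in C M.
Proof.
move=> A P Q ltA; have [P1 [Q1 [B1 [B2 [h1 h2 h3 h4 ->]]]]] := diag_decomp A P Q.
have hk R : covered R `<=` A -> M (hook_elt R).
  move=> sub; have [A' [B' [eA _ e _]]] := covered_halves R.
  have lt : A' #< C.
    by apply: card_lt_sub ltA => x hx; apply: sub; rewrite eA; left.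
  by apply: (IH lt).2; rewrite card_eq_sym.
have sg B : B `<=` A -> M (sing_elt B).
  by move=> sub; apply: (IH (card_lt_sub sub ltA)).1.
by do 2 ![apply: Mmul]; [exact: hk|exact: sg|exact: hk|exact: sg].
Qed.

Lemma infinite_generators : exists d e,
  [/\ M d, M e, normal C d /\ normal C e, all_hooks d /\ all_singletons e &
      all_hooks (star d) /\ all_singletons (star e) \/
      all_singletons (star d) /\ all_hooks (star e)].
Proof.
have [a [b [Ma Mb ea eb]]] := Mgen (or_introl infC).
move=> /generating_pairE[[ta tb] ha sb hs].
have ea' : hooks_type C (star a) \/ singles_type C (star a).
  by case: hs => -[h _]; [left|right].
have eb' : hooks_type C (star b) \/ singles_type C (star b).
  by case: hs => -[_ h]; [right|left].
have [d [Md nd td td']] := normalise infX infC Mmul Munit small_elements Ma ea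
  ta (or_introl ha) ea'.
have [e [Me ne te te']] := normalise infX infC Mmul Munit small_elements Mb eb
  tb (or_intror sb) eb'.
exists d, e; split=> //.
  split; first by case: td => -[h //]; case: (type_exclusive ha h).
  by case: te => -[h //]; case: (type_exclusive h sb).
case: hs => -[h1 h2]; [left|right]; split.
- by case: td' => -[h //]; case: (type_exclusive h1 h).
- by case: te' => -[h //]; case: (type_exclusive h h2).
- by case: td' => -[h //]; case: (type_exclusive h h1).
- by case: te' => -[h //]; case: (type_exclusive h2 h).
Qed.

(** The condition on the complement provides [|X|] transversals, so that invariants can be compared
    with those of the normalised generators. If these have the same type on both rows, they are
    copies of the wanted elements; otherwise two of them are multiplied. *)
Lemma hook_sing_infinite_room :
  (forall B, B #= C -> ~` B #= [set: X] -> M (sing_elt B)) /\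
  (forall P, edges P #= C -> ~` covered P #= [set: X] -> M (hook_elt P)).
Proof.
have [d [e [Md Me [nd ne] [hd se] hs]]] := infinite_generators.
have covC P : edges P #= C -> covered P #= C.
  move=> eP; rewrite -(card_eqr eP) card_eq_sym; apply: edges_infinite.
  by apply: card_eq_infinite infC; rewrite card_eq_sym.
have nC B P Q : B #= C -> ~` B #= [set: X] -> normal C (diag B P Q).
  by move=> eB hB; apply: normal_eq eB _; apply: normal_diag.
have sing_star B : star (sing_elt B) = sing_elt B by rewrite star_diag.
have sing_by c B : M c -> normal C c -> all_singletons c ->
    all_singletons (star c) -> B #= C -> ~` B #= [set: X] -> M (sing_elt B).
  move=> Mc nc h h' eB hB; apply: (closed_invariants Mc).
  apply: (same_type_invariants infC (nC _ _ _ eB hB) nc).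
    by right; split=> //; apply: all_singletons_diag.
  by rewrite sing_star; right; split=> //; apply: all_singletons_diag.
case: hs => -[hs1 hs2]; split.
- by move=> B; apply: sing_by hs2.
- move=> P eP hP; apply: (closed_invariants Md).
  apply: (same_type_invariants infC (nC _ _ _ (covC _ eP) hP) nd).
    by left; split=> //; apply: all_hooks_diag.
  by rewrite star_diag; left; split=> //; apply: all_hooks_diag.
(* Mixed case: [e] has singletons above and hooks below. A copy of [d] on the same support, with
   hooks above and singletons below, is multiplied on its right, which leaves singletons on both
   rows. *)
- have [de eC eX] := ne.
  have ee := diagonalE de.
  set L := lo_matching e in ee.
  have covL : covered L = ~` dom e.
    have e1 := domC_upper (star e).
    by rewrite hs2 setU0 dom_star diagonal_cod in e1.
  have Md' : M (diag (~` dom e) L (no_edges X)).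
    apply: (closed_invariants Md).
    apply: (same_type_invariants infC (nC _ _ _ eC _) nd); first by rewrite setCK.
      by left; split=> //; rewrite -covL; apply: all_hooks_diag.
    by rewrite star_diag; right; split=> //; apply: all_singletons_diag.
  have Me' : M (diag (~` dom e) (up_matching e) (no_edges X)).
    by have := Mmul Me Md'; rewrite {1}ee diag_mul.
  move=> B eB hB; apply: (sing_by _ _ Me') => //.
  + by apply: nC; rewrite ?setCK.
  + by move=> x y [_ _ /se].
  + by rewrite star_diag; apply: all_singletons_diag.
(* Likewise, [P] above with singletons below, times singletons above with [P] below, gives
   [hook_elt P]. *)
- move=> P eP hP.
  have M1 : M (diag (covered P) P (no_edges X)).
    apply: (closed_invariants Md).
    apply: (same_type_invariants infC (nC _ _ _ (covC _ eP) hP) nd).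
      by left; split=> //; apply: all_hooks_diag.
    by rewrite star_diag; right; split=> //; apply: all_singletons_diag.
  have M2 : M (diag (covered P) (no_edges X) P).
    apply: (closed_invariants Me).
    apply: (same_type_invariants infC (nC _ _ _ (covC _ eP) hP) ne).
      by right; split=> //; apply: all_singletons_diag.
    by rewrite star_diag; left; split=> //; apply: all_hooks_diag.
  by have := Mmul M1 M2; rewrite diag_mul.
Qed.


End InfiniteStep.

(** Induction on the cardinal of [A]. An infinite support is cut into two halves of its own size;
    each has the other in its complement, which therefore has the size of [X], and
    [hook_sing_infinite_room] applies to both. *)
Lemma hook_sing_closed A :
  M (sing_elt A) /\ forall P, edges P #= A -> M (hook_elt P).
Proof.
have [x0 _] : [set: X] !=set0 by apply: infinite_setN0.
apply: (card_ind x0 (P := fun A => M (sing_elt A) /\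
  forall P, edges P #= A -> M (hook_elt P))) => {}A IH.
have [[n An]|infA] := EM (finite_set A).
  split; first exact: sing_elt_finite An.
  by move=> P eP; apply: (@hook_elt_finite n); rewrite (card_eql eP).
have [rs rh] := hook_sing_infinite_room infA IH.
split.
  have [B1 [B2 [eA disj e1 e2]]] := card_infinite_split infA.
  have e12 : B1 #= B2 by rewrite (card_eql e1) card_eq_sym.
  have sub12 : B2 `<=` ~` B1.
    by move=> x x2 x1; move: disj; rewrite -subset0 => /(_ x); apply.
  have sub21 : B1 `<=` ~` B2.
    by move=> x x1 x2; move: disj; rewrite -subset0 => /(_ x); apply.
  rewrite eA sing_elt_split //; apply: Mmul; apply: rs => //.
    apply: card_setC_infinite => //; apply: card_le_trans (card_eqW e12) _.
    exact: subset_card_le.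
  apply: card_setC_infinite => //; rewrite -(card_le_eql e12).
  exact: subset_card_le.
move=> P eP.
have infP : infinite_set (edges P).
  by apply: card_eq_infinite infA; rewrite card_eq_sym.
have [E1 [E2 [eE disj e1 e2]]] := card_infinite_split infP.
have [N [Ncl eN1 eN2]] := edges_split eE disj.
rewrite (hook_elt_split Ncl).
set P1 := restrict N P; set P2 := restrict (~` N) P.
have c1 : covered P1 #= E1.
  rewrite card_eq_sym -eN1; apply: edges_infinite; rewrite eN1.
  by apply: card_eq_infinite infP; rewrite card_eq_sym.
have c2 : covered P2 #= E2.
  rewrite card_eq_sym -eN2; apply: edges_infinite; rewrite eN2.
  by apply: card_eq_infinite infP; rewrite card_eq_sym.
have c12 : covered P1 #= covered P2.
  by rewrite (card_eql c1) (card_eqr c2) (card_eql e1) card_eq_sym.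
have sub12 : covered P2 `<=` ~` covered P1.
  by move=> x /covered_restrict[nx _] /covered_restrict[].
have sub21 : covered P1 `<=` ~` covered P2.
  by move=> x /covered_restrict[Nx _] /covered_restrict[].
apply: Mmul; apply: rh.
- by rewrite eN1 (card_eql e1).
- apply: card_setC_infinite => //; rewrite (card_le_eql c12).
  exact: subset_card_le.
- by rewrite eN2 (card_eql e2).
- apply: card_setC_infinite => //; rewrite -(card_le_eql c12).
  exact: subset_card_le.
Qed.

Lemma extendable_closed a : extendable a -> M a.
Proof.
move=> /extendable_diagonal[f]; set b := brauer_mul a _ => /diagonalE db ->.
apply: Mmul; last exact/Munit/perm_elt_unit.
have [P1 [Q1 [B1 [B2 [_ _ _ _ eb]]]]] :=
  diag_decomp (~` dom b) (up_matching b) (lo_matching b).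
rewrite db eb.
have hk R : M (hook_elt R).
  have [A [_ [_ _ e _]]] := covered_halves R.
  by apply: (hook_sing_closed A).2; rewrite card_eq_sym.
by do 2 ![apply: Mmul]; do [exact: hk|exact: (hook_sing_closed _).1].
Qed.

End Sufficiency.


(** * The types every generating set must contain *)

Section Necessity.
Variable X : Type.
Implicit Types (P Q : matching X) (a b d : brauer X) (A B C N : set X).

Lemma card_le_setU_additive T U (A B : set T) (C : set U) : additive_card C ->
  A #<= C -> B #< C -> A `|` B #<= C.
Proof.
move=> [infC|C1] le lt; first by apply: card_le_setU => //; apply: card_lt_le.
by rewrite (card_lt_unit C1 lt) setU0.
Qed.

(** * Upper invariants of the second factor when the first has small defect *)

Section Factors.
Variables (C : set X) (a b : brauer X).
Hypotheses (aC : additive_card C) (ea : extendable a).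
Let ab := brauer_mul a b.

Lemma upper_hooks_mul : upper_hooks a `<=` upper_hooks ab.
Proof. by move=> _ [x [y [h ->]]]; exists x, y; split=> //; apply: mul_up. Qed.

Lemma upper_singletons_mul : upper_singletons a `<=` upper_singletons ab.
Proof. by move=> x h; apply: mul_up_isolated. Qed.

Lemma dom_mul : dom ab `<=` dom a.
Proof. by move=> x [y h]; apply: mul_dom h. Qed.

Lemma cod_mul : cod ab `<=` cod b.
Proof. by move=> y [x h]; apply: mul_cod h. Qed.

Lemma upper_singletons_factor :
  upper_singletons b `&` cod a #<= upper_singletons ab.
Proof.
apply: (card_le_rel (R := fun y x => tr a x y)).
  move=> y [h [x hx]]; exists x => //; exact: mul_up_isolated2 hx h.
by move=> y y' x _ _ _; apply: tr_fun.
Qed.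

(** Edges of [b] with both ends in [cod a] are pulled back along the transversals of [a],
    injectively. *)
Lemma edges_factor : [set e | edges (up_matching b) e /\ e `<=` cod a] #<=
  edges (up_matching ab).
Proof.
apply: (card_le_rel (R := fun e e' => exists x x' y y',
  [/\ up b y y', e = [set y; y'], tr a x y, tr a x' y' & e' = [set x; x']])).
  move=> _ [[y [y' [h ->]]] sub].
  have [x hx] : cod a y by apply: sub; left.
  have [x' hx'] : cod a y' by apply: sub; right.
  exists [set x; x']; last by exists x, x', y, y'.
  by exists x, x'; split=> //; apply: mul_up2 hx h hx'.
move=> e1 e2 e3 _ _ _ [x [x' [y [y' [h -> hx hx' ->]]]]].
move=> [z [z' [w [w' [k -> kz kz' e]]]]].
have h' : up_matching ab x x' := mul_up2 hx h hx'.
have k' : up_matching ab z z' := mul_up2 kz k kz'.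
have [[ez ez']|[ez ez']] := edge_eq h' k' e; subst z z'.
  by rewrite (tr_fun hx kz) (tr_fun hx' kz').
by rewrite (tr_fun hx kz') (tr_fun hx' kz) setUC.
Qed.

(** Each of these edges has an end outside [cod a], and an end determines its edge. *)
Lemma edges_outside : [set e | edges (up_matching b) e /\ ~ e `<=` cod a] #<=
  ~` cod a.
Proof.
apply: (card_le_rel (R := fun e y => e y)).
  move=> e [_ n]; apply: contrapT => H; apply: n => y ey.
  by apply: contrapT => ny; apply: H; exists y.
move=> e e' y [[x [z [h ->]]] _] [[x' [z' [h' ->]]] _] _.
move=> [/= e1|/= e1] [/= e2|/= e2]; subst y.
- by subst x'; rewrite (mfun h h').
- by subst z'; rewrite (mfun h (msym h')) setUC.
- by subst x'; rewrite (mfun (msym h) h') setUC.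
- by subst z'; rewrite (mfun (msym h) (msym h')).
Qed.

(** A vertex outside the domain of the product is outside [dom a], or is carried injectively by [a]
    to a vertex outside [dom b]. *)
Lemma domC_mul : ~` dom b #< C -> ~` dom a #< C -> ~` dom ab #< C.
Proof.
move=> hb ha; pose W := [set x | exists2 y, tr a x y & ~ dom b y].
apply: (@card_lt_sub _ _ _ (~` dom a `|` W)).
  move=> x nx; have [[y hy]|] := EM (dom a x); last by left.
  by right; exists y => // -[z hz]; apply: nx; exists z; apply: mul_tr hy hz.
apply: card_lt_setU => //; apply: card_le_lt_trans hb.
apply: (card_le_rel (R := tr a)) => [x [y h n]|]; first by exists y.
by move=> x x' y _ _ _; apply: tr_inj.
Qed.

Hypothesis small_a : ~` dom a #< C.

Lemma small_codC : ~` cod a #< C.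
Proof. exact: card_lt_eql (extendable_card ea) small_a. Qed.

Lemma factor_singletons_lt : upper_singletons ab #< C -> upper_singletons b #< C.
Proof.
move=> h; apply: (@card_lt_sub _ _ _ (upper_singletons b `&` cod a `|` ~` cod a)).
  by move=> y hy; have [ca|] := EM (cod a y); [left|right].
by apply: card_lt_setU small_codC => //; apply: card_le_lt_trans upper_singletons_factor h.
Qed.

Lemma factor_singletons_le : upper_singletons ab #<= C -> upper_singletons b #<= C.
Proof.
move=> h; apply: (@card_le_trans _ _ _ (upper_singletons b `&` cod a `|` ~` cod a)).
  by apply: subset_card_le => y hy; have [ca|] := EM (cod a y); [left|right].
apply: card_le_setU_additive small_codC => //.
exact: card_le_trans upper_singletons_factor h.
Qed.

Let edges_cases : edges (up_matching b) `<=`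
  [set e | edges (up_matching b) e /\ e `<=` cod a] `|`
  [set e | edges (up_matching b) e /\ ~ e `<=` cod a].
Proof. by move=> e he; have [s|s] := EM (e `<=` cod a); [left|right]. Qed.

Lemma factor_hooks_lt : upper_hooks ab #< C -> upper_hooks b #< C.
Proof.
move=> /(card_lt_eql (card_upper_hooks ab)) h.
have := card_upper_hooks b; rewrite card_eq_sym => /card_lt_eql; apply.
apply: card_lt_sub edges_cases _; apply: card_lt_setU => //.
  exact: card_le_lt_trans edges_factor h.
exact: card_le_lt_trans edges_outside small_codC.
Qed.

Lemma factor_hooks_le : upper_hooks ab #<= C -> upper_hooks b #<= C.
Proof.
rewrite !(card_le_eql (card_upper_hooks _)) => h.
apply: card_le_trans (subset_card_le edges_cases) _.
apply: card_le_setU_additive => //; first exact: card_le_trans edges_factor h.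
exact: card_le_lt_trans edges_outside small_codC.
Qed.

End Factors.

Lemma hooks_le_domC a : upper_hooks a #<= ~` dom a.
Proof.
rewrite (card_le_eql (card_upper_hooks a)).
apply: card_le_trans (edges_le_covered _) _; apply: subset_card_le.
by rewrite domC_upper; left.
Qed.

Lemma singletons_le_domC a : upper_singletons a #<= ~` dom a.
Proof. by apply: subset_card_le; rewrite domC_upper; right. Qed.

Definition many_transversals a := transversals a #= [set: X].

Lemma many_transversals_mul a b : many_transversals (brauer_mul a b) ->
  many_transversals a /\ many_transversals b.
Proof.
rewrite /many_transversals !(card_eql (card_transversals _)) => h.
split; rewrite card_eq_le card_leT /= -(card_le_eql h).
  exact/subset_card_le/dom_mul.
rewrite (card_le_eql (card_dom_cod _)) (card_le_eqr (card_dom_cod b)).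
exact/subset_card_le/cod_mul.
Qed.

Lemma not_card_lt_self T U (A : set T) (C : set U) : A #= C -> ~ (A #< C).
Proof. by move=> e [_]. Qed.

Lemma hooks_type_mul C a b : additive_card C -> extendable a ->
  hooks_type C (brauer_mul a b) -> hooks_type C a \/ hooks_type C b.
Proof.
move=> aC ea [hs hh].
have sa : upper_singletons a #< C.
  exact: card_lt_sub (@upper_singletons_mul a b) hs.
have la : upper_hooks a #<= C.
  by rewrite -(card_le_eqr hh); apply/subset_card_le/upper_hooks_mul.
have [e|n] := EM (upper_hooks a #= C); [by left|right].
have sm : ~` dom a #< C by apply: card_domC_small.
have sb := factor_singletons_lt aC ea sm hs.
split=> //; apply: card_le_anti.
  by apply: (factor_hooks_le aC ea sm); apply: card_eqW.
(* If [b] also had fewer than [|C|] hooks, both factors and hence the product would have small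
   defect, but the product has [|C|] hooks. *)
move=> hb; apply: (not_card_lt_self hh).
apply: card_le_lt_trans (hooks_le_domC _) _.
by apply: domC_mul => //; apply: card_domC_small.
Qed.

Lemma singles_type_mul C a b : additive_card C -> extendable a ->
  singles_type C (brauer_mul a b) -> singles_type C a \/ singles_type C b.
Proof.
move=> aC ea [hh hs].
have ha : upper_hooks a #< C.
  exact: card_lt_sub (@upper_hooks_mul a b) hh.
have la : upper_singletons a #<= C.
  by rewrite -(card_le_eqr hs); apply/subset_card_le/upper_singletons_mul.
have [e|n] := EM (upper_singletons a #= C); [by left|right].
have sm : ~` dom a #< C by apply: card_domC_small.
have hb := factor_hooks_lt aC ea sm hh.
split=> //; apply: card_le_anti.
  by apply: (factor_singletons_le aC ea sm); apply: card_eqW.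
move=> sb; apply: (not_card_lt_self hs).
apply: card_le_lt_trans (singletons_le_domC _) _.
by apply: domC_mul => //; apply: card_domC_small.
Qed.

(** The extendable elements without [T] form a subsemigroup containing the units. If it contained
    [U] as well, it would be all of [FX X], against the existence of an extendable element with
    [T]. *)
Lemma generators_contain (T : brauer X -> Prop) (U : set (brauer X)) :
  (forall a b, extendable a -> extendable b -> T (brauer_mul a b) -> T a \/ T b) ->
  (forall f, ~ T (perm_elt f)) ->
  (exists2 a, extendable a & T a) ->
  FX X = generated (brauer_units X `|` U) -> exists2 g, U g & T g.
Proof.
move=> Tmul Tunit [a ea Ta] FU; apply: contrapT => nU.
have : generated (brauer_units X `|` U) `<=` [set a | extendable a /\ ~ T a].
  apply: generated_sub.
    move=> c d [ec nc] [ed nd]; split; first exact: extendable_mul.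
    by move=> h; case: (Tmul _ _ ec ed h).
  move=> c [/unitP[f ->]|Uc]; first by split; [apply: extendable_perm|].
  split; last by move=> Tc; apply: nU; exists c.
  by rewrite -FXE FU; apply: sub_gen_smallest; right.
by rewrite -FU FXE => /(_ a ea)[].
Qed.

Lemma hooks_perm f : upper_hooks (@perm_elt X f) = set0.
Proof. by rewrite -subset0 => e [x [y [h _]]]; apply: up_perm h. Qed.

Lemma singletons_perm f : upper_singletons (@perm_elt X f) = set0.
Proof.
rewrite -subset0 => x /(_ (inr (f x))); apply.
exact/tr_perm.
Qed.

Lemma hooks_type_perm C f : additive_card C -> ~ hooks_type C (perm_elt f).
Proof.
move=> /additive_card_neq0/set0P/negP C0 [_].
by rewrite hooks_perm card_eq_sym card_eq0.
Qed.

Lemma singles_type_perm C f : additive_card C -> ~ singles_type C (perm_elt f).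
Proof.
move=> /additive_card_neq0/set0P/negP C0 [_].
by rewrite singletons_perm card_eq_sym card_eq0.
Qed.

Hypothesis infX : infinite_set [set: X].

Lemma edges_pairing (S : set X) (f : permutation X)
  (disj : forall x, S x -> ~ S (f x)) : edges (pairing disj) #= S.
Proof.
rewrite card_eq_sym.
apply: (card_eq_rel (R := fun x e => e = [set x; f x])).
- by move=> x Sx; exists [set x; f x] => //; exists x, (f x); split=> //; left.
- move=> _ [x [y [[[Sx ->]|[Sy ->]] ->]]]; first by exists x.
  by exists y => //; rewrite setUC.
- move=> x x' e Sx Sx' _ -> e'.
  have : [set x'; f x'] x by rewrite -e'; left.
  by move=> [//|/= e2]; case: (disj _ Sx'); rewrite -e2.
- by move=> x e e' _ _ _ -> ->.
Qed.

(** [C] may be all of [X], so it is first copied to a set [B] inside one half of [X]; this leaves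
    [|X|] transversals and room for a displaced copy of [B], whose points are the partners in the
    hooks. *)
Lemma exists_generating_pair C : additive_card C -> exists a b,
  [/\ extendable a, extendable b & generating_pair (cardinal_of C) a b].
Proof.
move=> aC; have C0 := additive_card_neq0 aC.
have [x0 _] : [set: X] !=set0 by apply: infinite_setN0.
have [D1 [D2 [eD D12 e1 e2]]] := card_infinite_split infX.
have leC : C #<= D1 by rewrite (card_le_eqr e1); apply: card_leT.
have [i [iD iinj]] := card_le_fun x0 leC.
pose B := i @` C.
have eB : B #= C.
  by apply: inj_card_eq => x y /set_mem Cx /set_mem Cy; apply: iinj.
have cB : ~` B #= [set: X].
  rewrite card_eq_le card_leT /= -(card_le_eql e2); apply: subset_card_le.
  move=> x D2x [y Cy eyx]; move: D12; rewrite -subset0 => /(_ x); apply.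
  by split=> //; rewrite -eyx; apply: iD.
have [f [disj cf]] := exists_displacement infX cB.
have disj' x : B x -> ~ B (f x).
  by move=> Bx Bfx; move: disj; rewrite -subset0 => /(_ (f x)); apply; split;
    [exists x|].
pose P := pairing disj'.
have eP : edges P #= C by apply: card_eq_trans eB; apply: edges_pairing.
exists (hook_elt P), (sing_elt B); split; try exact: extendable_diag.
have tP A U V : ~` A #= [set: X] -> transversals (diag A U V) #= [set: X].
  by move=> h; rewrite (card_eql (card_transversals _)) dom_diag.
have hP : hooks_type C (hook_elt P).
  split; last by rewrite (card_eql (card_edges_diag _ _)).
  by rewrite all_hooks_diag; apply: card_lt_set0.
have sB : singles_type C (sing_elt B).
  by split; rewrite ?hooks_sing ?singletons_sing //; apply: card_lt_set0.
apply/generating_pairE; split=> //.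
  by split; apply: tP => //; rewrite covered_pairing.
by left; rewrite /hook_elt /sing_elt !star_diag.
Qed.

Lemma type_domC_unit C a : C #= [set: unit] ->
  hooks_type C a \/ singles_type C a -> finite_set (~` dom a).
Proof.
move=> C1 h; have finC := unit_card_finite C1.
have [h1 h2] : upper_hooks a #<= C /\ upper_singletons a #<= C.
  by case: h => -[h1 h2]; split; try exact: card_lt_le; apply: card_eqW.
rewrite domC_upper finite_setU; split; last exact: card_le_finite h2 finC.
apply: finite_covered; apply: card_le_finite finC.
by rewrite -(card_le_eql (card_upper_hooks a)).
Qed.

(** The defects above and below agree. They equal [|C|] for infinite [C] and are finite for the
    cardinal one, so the two rows have the same cardinal attached to them. *)
Lemma type_card_eq C C' a : extendable a ->
  additive_card C -> additive_card C' ->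
  hooks_type C a \/ singles_type C a ->
  hooks_type C' (star a) \/ singles_type C' (star a) -> C #= C'.
Proof.
move=> ea aC aC' h h'.
have e : ~` dom a #= ~` dom (star a) by rewrite dom_star; apply: extendable_card.
case: aC aC' => [infC|C1] [infC'|C1'].
- have d := type_domC infC h; have d' := type_domC infC' h'.
  by rewrite -(card_eql d) -(card_eqr d').
- exfalso; apply: (infC); have fin := type_domC_unit C1' h'.
  by rewrite -(eq_finite_set (type_domC infC h)) (eq_finite_set e).
- exfalso; apply: (infC'); have fin := type_domC_unit C1 h.
  by rewrite -(eq_finite_set (type_domC infC' h')) -(eq_finite_set e).
- by rewrite (card_eql C1) card_eq_sym.
Qed.

End Necessity.


(** * Counting the generators *)

Lemma subset_finite_card_eq T (A B : set T) :
  finite_set B -> A `<=` B -> A #= B -> A = B.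
Proof.
move=> [n Bn] sub eAB; apply/seteqP; split=> // b Bb; apply: contrapT => nAb.
have : b |` A #= `I_n.+1.
  apply/eq_cardSP; exists b; first by left.
  by rewrite setUKD ?(card_eql eAB) // => x [-> /nAb].
rewrite card_eq_sym => /card_eqW le.
have : `I_n.+1 #<= `I_n.
  apply: card_le_trans le _; rewrite -(card_le_eqr Bn).
  by apply: subset_card_le => x [->//|/sub].
by rewrite card_le_II ltnn.
Qed.

Section Counting.
Variable X : Type.
Hypothesis infX : infinite_set [set: X].
Implicit Types (a b d : brauer X) (A B C N : set X) (m : set (set X)).

Let I := cardinal_one X `|` infinite_cardinals X.

Lemma indexP m : I m -> exists2 C, additive_card C & m = cardinal_of C.
Proof.
move=> [[C C1 <-]|[C /infiniteP infC <-]]; exists C => //; first by right.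
by left.
Qed.

Lemma index_additive C : additive_card C -> I (cardinal_of C).
Proof.
move=> [infC|C1]; [right|left]; exists C => //.
exact/infiniteP.
Qed.

Lemma cardinal_of_eq A B : A #= B -> cardinal_of A = cardinal_of B.
Proof.
move=> e; apply/seteqP; split=> D eD; first exact: card_eq_trans e.
by apply: card_eq_trans eD _; rewrite card_eq_sym.
Qed.

Lemma cardinal_of_inj A B : cardinal_of A = cardinal_of B -> A #= B.
Proof.
by move=> e; have h : cardinal_of A A := card_eqxx A; rewrite e in h.
Qed.

Lemma cardinal_oneE C m : C #= [set: unit] -> cardinal_one X m ->
  m = cardinal_of C.
Proof.
move=> C1 [A A1 <-]; apply: cardinal_of_eq.
by rewrite (card_eql A1) card_eq_sym.
Qed.

Section Enumeration.
Variables alpha beta : set (set X) -> brauer X.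
Variable C1 : set X.
Hypothesis C1_unit : C1 #= [set: unit].

(** The left summand indexes the pair for the cardinal one, represented by [C1]; the right summand
    indexes the pairs for the infinite cardinals. *)
Definition enumeration (k : nat + nat * set (set X)) : brauer X :=
  match k with
  | inl i => if i == 0 then alpha (cardinal_of C1) else beta (cardinal_of C1)
  | inr (i, m) => if i == 0 then alpha m else beta m
  end.

Lemma enumeration_image :
  enumeration @` two_plus_two_rho X = (alpha @` I) `|` (beta @` I).
Proof.
have I1 : I (cardinal_of C1) by apply: index_additive; right.
apply/seteqP; split=> [_ [k hk <-]|g].
  case: hk => [[i _ <-]|[[i m] [_ Im] <-]] /=; case: eqP => _;
    do [by left; eexists; first exact: I1|by right; eexists; first exact: I1|
        by left; exists m => //; right|by right; exists m => //; right].
move=> [] [m [m1|minf] <-].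
- rewrite (cardinal_oneE C1_unit m1); exists (inl 0) => //; left.
  by exists 0.
- by exists (inr (0, m)) => //; right; exists (0, m).
- rewrite (cardinal_oneE C1_unit m1); exists (inl 1) => //; left.
  by exists 1.
- by exists (inr (1, m)) => //; right; exists (1, m).
Qed.

Hypothesis alpha_type : forall C, additive_card C ->
  hooks_type C (alpha (cardinal_of C)).
Hypothesis beta_type : forall C, additive_card C ->
  singles_type C (beta (cardinal_of C)).

(** A common element would have [|C|] hooks and [|C'|] singletons, each number smaller than the
    other. *)
Lemma alpha_neq_beta m m' : I m -> I m' -> alpha m <> beta m'.
Proof.
move=> /indexP[C aC ->] /indexP[C' aC' ->] e.
have [sa ha] := alpha_type aC; have [hb sb] := beta_type aC'.
rewrite -e in hb sb.
have lt1 : C #< C' by apply: card_lt_eql ha hb.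
have lt2 : C' #< C by apply: card_lt_eql sb sa.
by move: lt1 => /card_ltNge; apply; apply: card_lt_le.
Qed.

Lemma alpha_inj m m' : I m -> I m' -> alpha m = alpha m' -> m = m'.
Proof.
move=> /indexP[C aC ->] /indexP[C' aC' ->] e.
have [_ ha] := alpha_type aC; have [_ ha'] := alpha_type aC'.
rewrite -e in ha'; apply: cardinal_of_eq.
by rewrite -(card_eql ha).
Qed.

Lemma beta_inj m m' : I m -> I m' -> beta m = beta m' -> m = m'.
Proof.
move=> /indexP[C aC ->] /indexP[C' aC' ->] e.
have [_ hb] := beta_type aC; have [_ hb'] := beta_type aC'.
rewrite -e in hb'; apply: cardinal_of_eq.
by rewrite -(card_eql hb).
Qed.

Lemma one_not_infinite : ~ infinite_cardinals X (cardinal_of C1).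
Proof.
move=> [A /infiniteP infA /cardinal_of_inj e]; apply: infA.
by rewrite (eq_finite_set e); apply: unit_card_finite.
Qed.

Lemma enumeration_inj : {in two_plus_two_rho X &, injective enumeration}.
Proof.
have I1 : I (cardinal_of C1) by apply: index_additive; right.
have Iinf m : infinite_cardinals X m -> I m by right.
have two i : `I_2 i -> i = 0 \/ i = 1 by case: i => [|[|]]; [left|right|].
move=> k k' /set_mem hk /set_mem hk'.
case: hk => [[i /two hi <-]|[[i m] [/= /two hi /[dup] m_inf /Iinf Im] <-]];
case: hk' => [[j /two hj <-]|[[j m'] [/= /two hj /[dup] m_inf' /Iinf Im'] <-]];
case: hi => ->; case: hj => -> //= e;
do [by case: (alpha_neq_beta _ _ e)|by case: (alpha_neq_beta _ _ (esym e))|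
    by rewrite (alpha_inj _ _ e)|by rewrite (beta_inj _ _ e)|
    by case: one_not_infinite; rewrite (alpha_inj _ _ e)|
    by case: one_not_infinite; rewrite (beta_inj _ _ e)|
    by case: one_not_infinite; rewrite -(alpha_inj _ _ e)|
    by case: one_not_infinite; rewrite -(beta_inj _ _ e)].
Qed.

Lemma card_enumeration :
  (alpha @` I) `|` (beta @` I) #= two_plus_two_rho X.
Proof. by rewrite -enumeration_image; apply: inj_card_eq enumeration_inj. Qed.

End Enumeration.

Lemma exists_unit_set : exists C : set X, C #= [set: unit].
Proof.
have [x0 _] : [set: X] !=set0 by apply: infinite_setN0.
by exists [set x0]; apply: card_set1_unit.
Qed.

Lemma generating_types C a b : generating_pair (cardinal_of C) a b ->
  hooks_type C a /\ singles_type C b.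
Proof. by move=> /generating_pairE[]. Qed.

Lemma generating_pairs_generate (alpha beta : set (set X) -> brauer X) :
  (alpha @` I) `|` (beta @` I) `<=` FX X ->
  (forall m, I m -> generating_pair m (alpha m) (beta m)) ->
  FX X = generated (brauer_units X `|` ((alpha @` I) `|` (beta @` I))).
Proof.
set U := _ `|` (beta @` I) => UF gp.
apply/seteqP; split; last first.
  apply: generated_sub; first exact: generated_closed.
  move=> a [/unitP[f ->]|/UF//]; rewrite FXE; exact: extendable_perm.
rewrite FXE => a; apply: extendable_closed => //; first exact: generated_closed.
  by move=> b ub; apply: sub_gen_smallest; left.
move=> C aC; have IC := index_additive aC.
have Ua : U (alpha (cardinal_of C)) by left; exists (cardinal_of C).
have Ub : U (beta (cardinal_of C)) by right; exists (cardinal_of C).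
exists (alpha (cardinal_of C)), (beta (cardinal_of C)).
rewrite -FXE; split; [by apply: sub_gen_smallest; right|
  by apply: sub_gen_smallest; right|exact: UF|exact: UF|exact: gp].
Qed.

Lemma exists_generating_pairs : exists alpha beta : set (set X) -> brauer X,
  (alpha @` I) `|` (beta @` I) `<=` FX X /\
  forall m, I m -> generating_pair m (alpha m) (beta m).
Proof.
have /choice[f fP] : forall m, exists p : brauer X * brauer X, I m ->
    [/\ extendable p.1, extendable p.2 & generating_pair m p.1 p.2].
  move=> m; have [/indexP[C aC ->]|n] := EM (I m).
    by have [a [b H]] := exists_generating_pair infX aC; exists (a, b).
  by exists (brauer_one X, brauer_one X).
exists (fun m => (f m).1), (fun m => (f m).2); split=> [_ [] [m Im <-]|m /fP[]//];
  by rewrite FXE; have [] := fP _ Im.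
Qed.

(** Taking [side] to be the identity or the reflection treats the upper and the lower row at once;
    the reflection only exchanges the factors of a product. *)
Lemma generators_of_type (side : brauer X -> brauer X) (U : set (brauer X)) C :
  side = id \/ side = @star X -> additive_card C ->
  FX X = generated (brauer_units X `|` U) ->
  (exists2 a, U a & many_transversals a /\ hooks_type C (side a)) /\
  (exists2 a, U a & many_transversals a /\ singles_type C (side a)).
Proof.
move=> hside aC FU.
have sext a : extendable a -> extendable (side a).
  by case: hside => -> //; apply: star_extendable.
have smul (T : brauer X -> Prop) a b :
    (forall c d, extendable c -> T (brauer_mul c d) -> T c \/ T d) ->
    extendable a -> extendable b -> T (side (brauer_mul a b)) ->
    T (side a) \/ T (side b).
  move=> h ea eb; case: hside => ->; first exact: h.
  by rewrite star_mul => /(h _ _ (star_extendable eb)); rewrite or_comm.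
have sperm f : exists g, side (perm_elt f) = perm_elt g.
  by case: hside => ->; [exists f|exists (perm_inv f); rewrite star_perm].
have [a [b [ea eb /generating_pairE[[ta tb] ha sb h]]]] :=
  exists_generating_pair infX aC.
split; apply: generators_contain FU.
- move=> c d ec ed [/many_transversals_mul[mc md]] /(smul _ _ _ _ ec ed).
  by case=> [c' d' ec'|?|?]; [exact: hooks_type_mul|left|right].
- by move=> f [_]; have [g ->] := sperm f; apply: hooks_type_perm.
- case: hside => ->; first by exists a.
  by case: h => -[h1 h2]; [exists a|exists b].
- move=> c d ec ed [/many_transversals_mul[mc md]] /(smul _ _ _ _ ec ed).
  by case=> [c' d' ec'|?|?]; [exact: singles_type_mul|left|right].
- by move=> f [_]; have [g ->] := sperm f; apply: singles_type_perm.
- case: hside => ->; first by exists b.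
  by case: h => -[h1 h2]; [exists b|exists a].
Qed.

(** One generator of each upper type is chosen for each cardinal; equinumerous representatives
    define the same types. *)
Lemma generators_choice (U : set (brauer X)) :
  FX X = generated (brauer_units X `|` U) ->
  exists alpha beta : set (set X) -> brauer X,
  [/\ (alpha @` I) `|` (beta @` I) `<=` U,
      forall C, additive_card C -> many_transversals (alpha (cardinal_of C)) /\
        hooks_type C (alpha (cardinal_of C)) &
      forall C, additive_card C -> many_transversals (beta (cardinal_of C)) /\
        singles_type C (beta (cardinal_of C))].
Proof.
move=> FU.
have /choice[f fP] : forall m, exists p : brauer X * brauer X,
    forall C, additive_card C -> m = cardinal_of C ->
    [/\ U p.1, U p.2, many_transversals p.1 /\ hooks_type C p.1 &
        many_transversals p.2 /\ singles_type C p.2].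
  move=> m; have [/indexP[C aC ->]|n] := EM (I m); last first.
    exists (brauer_one X, brauer_one X) => C aC em.
    by case: n; rewrite em; apply: index_additive.
  have [[a Ua [ta ha]] [b Ub [tb sb]]] :=
    generators_of_type (or_introl erefl) aC FU.
  exists (a, b) => C' aC' /cardinal_of_inj e.
  split=> //; split=> //.
    by case: ha => h1 h2; split; [apply: card_lt_eqr e h1|apply: card_eq_trans e].
  by case: sb => h1 h2; split; [apply: card_lt_eqr e h1|apply: card_eq_trans e].
exists (fun m => (f m).1), (fun m => (f m).2); split.
- by move=> _ [] [m /indexP[C aC ->] <-]; have [] := fP _ C aC erefl.
- by move=> C aC; have [] := fP _ C aC erefl.
- by move=> C aC; have [] := fP _ C aC erefl.
Qed.

End Counting.

(** * The relative rank, and the generating sets of that size *)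

Theorem theorem6p16 (X : Type) (X_infinite : infinite_set [set: X]) :
  relative_rank_is (FX X) (brauer_units X) (two_plus_two_rho X) /\
  (finite_set (infinite_cardinals X) ->
   forall Omega : set (brauer X),
     Omega `<=` FX X -> Omega #= two_plus_two_rho X ->
     (FX X = generated (brauer_units X `|` Omega) <->
      exists alpha beta : set (set X) -> brauer X,
        let I := cardinal_one X `|` infinite_cardinals X in
        Omega = (alpha @` I) `|` (beta @` I) /\
        forall m, I m -> generating_pair m (alpha m) (beta m))).
Proof.
have [C1 C1u] := exists_unit_set X_infinite.
split; first split.
- have [al [be [UF gp]]] := exists_generating_pairs X_infinite.
  exists ((al @` (cardinal_one X `|` infinite_cardinals X)) `|`
          (be @` (cardinal_one X `|` infinite_cardinals X))); split=> //.
    exact: generating_pairs_generate.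
  by apply: (card_enumeration C1u) => C /index_additive/gp/generating_types[].
- move=> U UF /(generators_choice X_infinite)[al [be [sub ta tb]]].
  apply: card_le_trans (subset_card_le sub).
  apply: card_eqW; rewrite card_eq_sym; apply: (card_enumeration C1u) => C aC.
    exact: (ta C aC).2.
  exact: (tb C aC).2.
move=> fin Omega OF Ocard; split; last first.
  move=> [al [be [eO gp]]]; rewrite eO in OF *.
  exact: generating_pairs_generate.
move=> gen; have [al [be [sub ta tb]]] := generators_choice X_infinite gen.
pose I := cardinal_one X `|` infinite_cardinals X.
have eK : (al @` I) `|` (be @` I) #= two_plus_two_rho X.
  apply: (card_enumeration C1u) => C aC; first exact: (ta C aC).2.
  exact: (tb C aC).2.
have finO : finite_set Omega.
  rewrite (eq_finite_set Ocard) /two_plus_two_rho /card_add finite_setU.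
  split; apply: finite_image; first exact: finite_II.
  by apply: finite_setX => //; exact: finite_II.
(* The chosen generators form a subset of [Omega] of the same finite cardinality, so they are all of
   [Omega]. *)
have eO : (al @` I) `|` (be @` I) = Omega.
  by apply: subset_finite_card_eq => //; rewrite (card_eql eK) card_eq_sym.
exists al, be; split=> // m /indexP[C aC ->].
(* The choice of [al] and [be] fixes only the upper types. For the lower rows, [Omega] must contain
   elements of both lower types for [C]. *)
have [[g1 O1 [_ h1]] [g2 O2 [_ s2]]] :=
  generators_of_type X_infinite (or_intror erefl) aC gen.
(* By [type_card_eq], an element with a lower type for [C] has its upper type for the same cardinal,
   hence is one of the two elements indexed by [C]. *)
have find g : Omega g -> hooks_type C (star g) \/ singles_type C (star g) ->
    g = al (cardinal_of C) \/ g = be (cardinal_of C).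
  move=> Og tg; have eg : extendable g by rewrite -FXE; apply: OF.
  move: (Og); rewrite -eO => -[] [m' /indexP[C' aC' ->] eg'].
    left; rewrite -eg'; congr al; apply: cardinal_of_eq.
    apply: (type_card_eq eg aC' aC _ tg).
    by left; rewrite -eg'; apply: (ta C' aC').2.
  right; rewrite -eg'; congr be; apply: cardinal_of_eq.
  apply: (type_card_eq eg aC' aC _ tg).
  by right; rewrite -eg'; apply: (tb C' aC').2.
apply/generating_pairE; have [tal hal] := ta C aC; have [tbe sbe] := tb C aC.
split=> //.
(* [g1] and [g2] are different, since no element has both lower types; the two ways of matching them
   with [al] and [be] are the two alternatives for the lower rows. *)
have [e1|e1] := find _ O1 (or_introl h1); have [e2|e2] := find _ O2 (or_intror s2).
- by case: (@type_exclusive _ C (star g1)) => //; rewrite e1 -e2.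
- by left; rewrite -e1 -e2.
- by right; rewrite -e1 -e2.
- by case: (@type_exclusive _ C (star g1)) => //; rewrite e1 -e2.
Qed.
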